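(* There is a deterministic logspace algorithm (logspace transducer) which, given a directed acyclic graph $G$ (with no loops or multiple arcs), outputs a minimal path decomposition of $G$.
   Context: A path decomposition of a directed graph $G$ (with no loops or multiple arcs) is a family of simple directed paths such that every edge of $G$ lies on exactly one path of the family; equivalently, a partition of the edge set of $G$ into edge-disjoint directed paths. A minimal path decomposition of $G$ is a path decomposition of $G$ with the smallest possible number of paths; this number is called the path number of $G$. A logspace transducer has a read-only input tape, a write-only output tape, and a work tape of size $O(\log n)$, where $n$ is the number of vertices. *)

(* Defs.v *)
From mathcomp Require Import all_boot.

Set Implicit Arguments.
Unset Strict Implicit.
Unset Printing Implicit Defensive.

(* A digraph without multiple arcs on a finite vertex type T is a relation
   e : rel T; it has no loops when e is irreflexive. *)

Section Paths.
Variables (T : finType) (e : rel T).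

Definition acyclic := forall c : seq T, ucycle e c -> c = [::].

(* Paths are given by their vertex sequences; one-vertex paths, which have no
   arc, are allowed (no minimal decomposition contains any). *)
Definition simple_path (p : seq T) := [&& p != [::], sorted e p & uniq p].

Definition arcs (p : seq T) : seq (T * T) := zip p (behead p).

Definition path_decomposition (D : seq (seq T)) :=
  all simple_path D /\
  forall x y, e x y -> count (fun p => (x, y) \in arcs p) D = 1.

Definition minimal_path_decomposition (D : seq (seq T)) :=
  path_decomposition D /\
  forall D', path_decomposition D' -> size D <= size D'.

End Paths.

Inductive in_sym := Entry of bool | EndRow.
Inductive out_sym := Digit of bool | EndVertex | EndPath.

(* Row-major adjacency matrix. *)
Definition graph_code n (e : rel 'I_n) : seq in_sym :=
  flatten [seq rcons [seq Entry (e i j) | j <- enum 'I_n] EndRow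
          | i <- enum 'I_n].

(* Binary numeral, most significant digit first, no superfluous leading zero
   (binary 0 = [:: false]). *)
Definition binary (m : nat) : seq bool :=
  [seq odd (m %/ 2 ^ i) | i <- rev (iota 0 (trunc_log 2 m).+1)].

Definition vertex_code n (i : 'I_n) : seq out_sym :=
  rcons [seq Digit b | b <- binary i] EndVertex.

Definition path_code n (p : seq 'I_n) : seq out_sym :=
  rcons (flatten [seq vertex_code i | i <- p]) EndPath.

Definition decomposition_code n (D : seq (seq 'I_n)) : seq out_sym :=
  flatten [seq path_code p | p <- D].

Inductive move := Left | Stay | Right.

Inductive in_cell := LeftEnd | Sym of in_sym | RightEnd.

Record action (Q W : Type) := Action {
  next_state : Q;
  written : W;
  in_move : move;
  work_move : move;
  emitted : option out_sym
}.

(* Deterministic Turing machine with a two-way read-only input tape, one work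
   tape, infinite to the right, and a one-way write-only output tape.
   The machine halts when delta returns None. *)
Record transducer := Transducer {
  state : finType;
  work_sym : finType;
  start : state;
  blank : work_sym;
  delta : state -> in_cell -> work_sym -> option (action state work_sym)
}.

Record config (M : transducer) := Config {
  cstate : state M;
  in_pos : nat;
  work_tape : nat -> work_sym M;
  work_pos : nat;
  output : seq out_sym
}.

(* The input word w occupies cells 1, ..., size w, between end markers in cells
   0 and (size w).+1.  The input head must not leave these cells: otherwise its
   position would be an unbounded counter outside the space bound. *)
Definition in_read (w : seq in_sym) (i : nat) : in_cell :=
  nth RightEnd (LeftEnd :: [seq Sym a | a <- w]) i.

Definition move_head (d : move) (i : nat) : nat :=
  match d with Left => i.-1 | Stay => i | Right => i.+1 end.

Section Run.
Variables (M : transducer) (w : seq in_sym).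

Definition init : config M := Config (start M) 0 (fun _ => blank M) 0 [::].

Definition step (c : config M) : option (config M) :=
  match delta (cstate c) (in_read w (in_pos c)) (work_tape c (work_pos c)) with
  | None => None
  | Some a => Some (Config
      (next_state a)
      (minn (move_head (in_move a) (in_pos c)) (size w).+1)
      [eta work_tape c with work_pos c |-> written a]
      (move_head (work_move a) (work_pos c))
      (if emitted a is Some s then rcons (output c) s else output c))
  end.

Definition run (t : nat) : config M := iter t (fun c => odflt c (step c)) init.

Definition halts_with (s : seq out_sym) :=
  exists t, step (run t) = None /\ output (run t) = s.

(* Only the first s cells of the work tape are ever visited. *)
Definition work_space_le (s : nat) := forall t, work_pos (run t) < s.

End Run.

(* O(log n) work space on digraphs with n vertices, acyclic or not;
   (trunc_log 2 n).+1 = floor (log2 n) + 1 stays positive for n <= 1. *)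
Definition logspace (M : transducer) :=
  exists c : nat, forall (n : nat) (e : rel 'I_n), irreflexive e ->
    work_space_le M (graph_code e) (c * (trunc_log 2 n).+1).

(* Main.v *)
(* At every vertex, pair the k-th incoming arc with the k-th outgoing arc. In an
   acyclic graph the chains of paired arcs are simple paths, and exactly
   max(0, outdeg v - indeg v) of them start at v. This is optimal: a path of an
   arbitrary decomposition that leaves v either enters v or starts there.
   The successor of an arc is found by counting, so a chain can be printed from
   its first arc with a constant number of counters bounded by n. The counters
   are stored in binary on parallel tracks of the work tape. *)

From Stdlib Require Import FunctionalExtensionality.
Require Import Defs.
From mathcomp Require Import all_boot.

Set Implicit Arguments.
Unset Strict Implicit.
Unset Printing Implicit Defensive.

(** The space bound must also hold on graphs with cycles, where a chain of paired arcs can be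
    infinite. For this reason the algorithm is written in a small language in which every loop makes
    [n] rounds and no register exceeds [n]: termination and the space bound then hold for every
    program and every input graph, and acyclicity is used for the correctness of the output.

    The length of a binary counter is not known when the machine starts, so the tracks are not laid
    out in advance. The used part of the work tape begins as a single cell, is shared by all
    registers, and grows by one cell when an increment carries out of it. As values stay at most
    [n], its length stays at most [(trunc_log 2 n).+1].

    The value [n] itself is not a vertex and serves as a null value: it marks the end of a path, and
    looking up an arc at it yields false. *)

Definition upd (K : eqType) A (f : K -> A) k a := fun x => if x == k then a else f x.

Lemma upd_id (K : eqType) A (f : K -> A) k : upd f k (f k) = f.
Proof. by apply: functional_extensionality => x; rewrite /upd; case: eqP => [->|]. Qed.

Lemma upd_same (K : eqType) A (f : K -> A) k a : upd f k a k = a.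
Proof. by rewrite /upd eqxx. Qed.

Lemma upd_upd (K : eqType) A (f : K -> A) k a b : upd (upd f k a) k b = upd f k b.
Proof. by apply: functional_extensionality => x; rewrite /upd; case: eqP. Qed.

(** * Structured programs *)

Section Programs.
Variable W : finType.

Record effect := Effect {
  eff_flag : bool;
  eff_sym : W;
  eff_in : move;
  eff_work : move;
  eff_out : option out_sym
}.

Definition test := bool -> in_cell -> W -> bool.

(* Besides the program counter, the finite control holds one boolean flag, by
   which a program returns a truth value. *)
Inductive prog :=
| Prim of bool -> in_cell -> W -> effect
| Seq of prog & prog
| Ite of test & prog & prog
| Loop of test & prog.

Fixpoint pc (p : prog) : finType :=
  match p with
  | Prim _ => unit
  | Seq p q => (pc p + pc q)%type
  | Ite _ p q => option (pc p + pc q)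
  | Loop _ p => option (pc p)
  end.

Fixpoint entry (p : prog) : pc p :=
  match p with
  | Prim _ => tt
  | Seq p q => inl (entry p)
  | Ite _ p q => None
  | Loop _ p => None
  end.

Definition idle (x : bool) (a : W) := Effect x a Stay Stay None.

(* The program counter [None] means exit. *)
Fixpoint advance (p : prog) :
    pc p -> bool -> in_cell -> W -> option (pc p) * effect :=
  match p with
  | Prim f => fun _ x c a => (None, f x c a)
  | Seq p q => fun s x c a =>
      match s with
      | inl s => let r := advance s x c a in
          (Some (if r.1 is Some s' then inl s' else inr (entry q)), r.2)
      | inr s => let r := advance s x c a in (omap inr r.1, r.2)
      end
  | Ite b p q => fun s x c a =>
      match s with
      | None =>
          (Some (Some (if b x c a then inl (entry p) else inr (entry q))),
           idle x a)
      | Some (inl s) => let r := advance s x c a in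
          (omap (fun s' => Some (inl s')) r.1, r.2)
      | Some (inr s) => let r := advance s x c a in
          (omap (fun s' => Some (inr s')) r.1, r.2)
      end
  | Loop b p => fun s x c a =>
      match s with
      | None => (if b x c a then Some (Some (entry p)) else None, idle x a)
      | Some s => let r := advance s x c a in (Some r.1, r.2)
      end
  end.

Record memory := Memory {
  flag : bool;
  ipos : nat;
  tape : nat -> W;
  wpos : nat;
  out : seq out_sym
}.

Definition add_out (o : option out_sym) s := if o is Some a then rcons s a else s.

Variables (w : seq in_sym) (S : nat).

Definition move_in d i :=
  match d with Left => i.-1 | Stay => i | Right => minn i.+1 (size w).+1 end.

Definition perform (f : bool -> in_cell -> W -> effect) (m : memory) : memory :=
  let E := f (flag m) (in_read w (ipos m)) (tape m (wpos m)) in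
  Memory (eff_flag E) (move_in (eff_in E) (ipos m))
    (upd (tape m) (wpos m) (eff_sym E)) (move_head (eff_work E) (wpos m))
    (add_out (eff_out E) (out m)).

Definition holds (b : test) (m : memory) :=
  b (flag m) (in_read w (ipos m)) (tape m (wpos m)).

(** The premises [wpos m < S] accompany every machine step, tests included, so that a single
    derivation yields both termination and the space bound. *)
Inductive exec : prog -> memory -> memory -> Prop :=
| exec_prim f m : wpos m < S -> exec (Prim f) m (perform f m)
| exec_seq p q m1 m2 m3 :
    exec p m1 m2 -> exec q m2 m3 -> exec (Seq p q) m1 m3
| exec_ite b p q m m' : wpos m < S ->
    exec (if holds b m then p else q) m m' -> exec (Ite b p q) m m'
| exec_exit b p m : wpos m < S -> ~~ holds b m -> exec (Loop b p) m m
| exec_iter b p m1 m2 m3 : wpos m1 < S -> holds b m1 ->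
    exec p m1 m2 -> exec (Loop b p) m2 m3 -> exec (Loop b p) m1 m3.

Inductive reach p : option (pc p) -> memory -> option (pc p) -> memory -> Prop :=
| reach0 o m : reach o m o m
| reachS s m o m' : wpos m < S ->
    reach (advance s (flag m) (in_read w (ipos m)) (tape m (wpos m))).1
      (perform (fun x c a => (advance s x c a).2) m) o m' ->
    reach (Some s) m o m'.

Lemma reach_trans p o1 m1 o2 m2 o3 m3 :
  @reach p o1 m1 o2 m2 -> reach o2 m2 o3 m3 -> reach o1 m1 o3 m3.
Proof.
move=> h; elim: h o3 m3 => // s m o m' lt_m _ IH o3 m3 h3.
by apply: reachS (IH _ _ h3).
Qed.

(** A simulation that carries runs of a component into a compound program: [h] embeds the control
    states, and [g] also tells where control goes when the component exits. *)
Lemma reach_map p q (g : option (pc p) -> option (pc q)) (h : pc p -> pc q) :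
  (forall s, g (Some s) = Some (h s)) ->
  (forall s x c a, advance (h s) x c a = (g (advance s x c a).1, (advance s x c a).2)) ->
  forall o m o' m', reach o m o' m' -> reach (g o) m (g o') m'.
Proof.
move=> gE advanceE o m o' m'; elim=> [o1 m1|s m1 o1 m2 lt_m _ IH].
  exact: reach0.
rewrite gE; apply: reachS => //.
rewrite advanceE /=; move: IH.
congr (reach _ _ _ _); rewrite /perform.
by rewrite !advanceE.
Qed.

Lemma idleE m : perform (fun x _ a => idle x a) m = m.
Proof. by case: m => x i t k o; rewrite /perform /= upd_id. Qed.

Lemma exec_reach p m m' : exec p m m' -> reach (Some (entry p)) m None m'.
Proof.
elim=> {p m m'}.
- by move=> f m lt_m; apply: reachS => //; apply: reach0.
- move=> p q m1 m2 m3 _ IHp _ IHq.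
  pose gl (o : option (pc p)) : option (pc (Seq p q)) :=
    Some (if o is Some s then inl s else inr (entry q)).
  pose gr (o : option (pc q)) : option (pc (Seq p q)) := omap inr o.
  apply: (@reach_trans _ _ _ (gl None) m2).
    by have := @reach_map _ _ gl inl (fun _ => erefl) (fun _ _ _ _ => erefl)
      _ _ _ _ IHp.
  by have := @reach_map _ _ gr inr (fun _ => erefl) (fun _ _ _ _ => erefl)
      _ _ _ _ IHq.
- move=> b p q m m' lt_m _ IH; apply: reachS => //=.
  rewrite -/(holds b m) (idleE m); case: (holds b m) IH => IH.
    by have := @reach_map p (Ite b p q) (omap (fun s => Some (inl s)))
      (fun s => Some (inl s)) (fun _ => erefl) (fun _ _ _ _ => erefl)
      _ _ _ _ IH.
  by have := @reach_map q (Ite b p q) (omap (fun s => Some (inr s)))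
      (fun s => Some (inr s)) (fun _ => erefl) (fun _ _ _ _ => erefl)
      _ _ _ _ IH.
- move=> b p m lt_m nb; apply: reachS => //=.
  by rewrite -/(holds b m) (idleE m) (negPf nb); apply: reach0.
- move=> b p m1 m2 m3 lt_m hb _ IH1 _ IH2; apply: reachS => //=.
  rewrite -/(holds b m1) (idleE m1) hb; apply: reach_trans IH2.
  by have := @reach_map p (Loop b p) Some Some (fun _ => erefl)
    (fun _ _ _ _ => erefl) _ _ _ _ IH1.
Qed.

End Programs.

Arguments Prim {W}.
Arguments Effect {W}.
Arguments Memory {W}.

(** * From structured programs to transducers *)

Section Machine.
Variables (W : finType) (a0 : W) (p : prog W).

Definition machine : transducer :=
  @Transducer (option (pc p) * bool)%type W (Some (entry p), false) a0
    (fun s c a =>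
       if s.1 is Some s1 then
         let r := advance s1 s.2 c a in
         Some (@Action _ W (r.1, eff_flag r.2) (eff_sym r.2) (eff_in r.2) (eff_work r.2)
           (eff_out r.2))
       else None).

Definition conf o (m : memory W) : config machine :=
  @Config machine (o, flag m) (ipos m) (tape m) (wpos m) (out m).

(** [perform] truncates only moves to the right, [step] truncates all of them; the two agree while
    the head is within the end markers, hence the bound on [ipos m]. The premise on [m'] covers the
    last configuration, where no step checks the work head. *)
Lemma run_reach w S o m o' m' : reach w S o m o' m' -> wpos m' < S ->
  ipos m <= (size w).+1 ->
  exists t, iter t (fun c => odflt c (step w c)) (conf o m) = conf o' m' /\
    forall i, i <= t ->
      work_pos (iter i (fun c => odflt c (step w c)) (conf o m)) < S.
Proof.
elim=> {o m o' m'} [o m lt_m _|s m o m' lt_m _ IH lt_m' le_m].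
  by exists 0; split=> // -[].
have [|t [run_t space_t]] := IH lt_m'.
  rewrite /perform /=; case: (eff_in _) => /=.
  - exact: leq_trans (leq_pred _) le_m.
  - by [].
  - exact: geq_minr.
pose c1 := conf (advance s (flag m) (in_read w (ipos m)) (tape m (wpos m))).1
      (perform w (fun x c a => (advance s x c a).2) m).
have step1 : odflt (conf (Some s) m) (step w (conf (Some s) m)) = c1.
  rewrite /step /c1 /perform /=; congr Config.
  case: (eff_in _) => /=; last by [].
  - by apply/minn_idPl; apply: leq_trans (leq_pred _) le_m.
  - exact/minn_idPl.
exists t.+1; split; first by rewrite iterSr step1.
by move=> [//|i] lt_i; rewrite iterSr step1; apply: space_t.
Qed.

Lemma machine_halts w S m : exec w S p (Memory false 0 (fun=> a0) 0 [::]) m ->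
  wpos m < S -> halts_with machine w (out m) /\ work_space_le machine w S.
Proof.
move=> /exec_reach run_p lt_m.
have [//|t [run_t space_t]] := run_reach run_p lt_m.
have halted : step w (run machine w t) = None by rewrite /run run_t.
split; first by exists t; split=> //; rewrite /run run_t.
move=> i; have [le_it|/ltnW le_ti] := leqP i t; first exact: space_t.
(* A halted machine repeats its last configuration, so the bound at time [t] serves all later
   times. *)
rewrite -(subnK le_ti); elim: (i - t) => [|k IHk].
  by rewrite add0n /run run_t.
suff -> : run machine w (k.+1 + t) = run machine w t by rewrite /run run_t.
elim: k.+1 => // l IHl; rewrite addSn /run iterS -/(run machine w (l + t)) IHl.
by rewrite halted.
Qed.

End Machine.

(** * Binary digits *)

Lemma digits_inj w a b : a < 2 ^ w -> b < 2 ^ w ->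
  (forall i, i < w -> odd (a %/ 2 ^ i) = odd (b %/ 2 ^ i)) -> a = b.
Proof.
elim: w a b => [|w IHw] a b.
  by rewrite expn0 !ltnS !leqn0 => /eqP-> /eqP->.
rewrite expnS !mul2n => lt_a lt_b eq_ab.
have eq_odd : odd a = odd b by have := eq_ab 0 isT; rewrite expn0 !divn1.
rewrite -(odd_double_half a) -(odd_double_half b) eq_odd.
congr (_ + _.*2); apply: IHw; rewrite ?ltn_half_double // => i lt_iw.
by have := eq_ab i.+1 lt_iw; rewrite expnS !divnMA !divn2.
Qed.

(** When 1 is added to [a], the carry reaches position [i] exactly if [2 ^ i] divides [a.+1]; the
    digit there flips in this case only. *)
Lemma odd_divS a i :
  odd (a.+1 %/ 2 ^ i) = odd (a %/ 2 ^ i) (+) (2 ^ i %| a.+1).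
Proof. by rewrite divnS ?expn_gt0 // oddD addbC; case: (_ %| _). Qed.

(** The propagation rule of the carry: it passes position [i] if it arrives there and meets the
    digit 1. *)
Lemma dvd_carry a i :
  (2 ^ i.+1 %| a.+1) = (2 ^ i %| a.+1) && odd (a %/ 2 ^ i).
Proof.
have [/dvdnP[q aE]|ndvd] := boolP (2 ^ i %| a.+1); last first.
  by apply: contraNF ndvd; apply: dvdn_trans; rewrite expnS dvdn_mull.
rewrite {1}aE expnS dvdn_pmul2r ?expn_gt0 // dvdn2.
have := odd_divS a i; rewrite aE mulnK ?expn_gt0 // dvdn_mull // addbT.
by move->; rewrite negbK.
Qed.

(** * Registers on the work tape *)

Section Registers.
Variable K : finType.

(* A cell stores: whether it is the leftmost one, whether it belongs to the
   used part of the tape, and one binary digit of every register, the leftmost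
   cell holding the units. *)
Definition cell : finType := (bool * bool * {ffun K -> bool})%type.
Definition is_first (a : cell) := a.1.1.
Definition is_used (a : cell) := a.1.2.
Definition digit (a : cell) : K -> bool := (a : bool * bool * {ffun K -> bool}).2.
Definition set_digit (a : cell) k b : cell :=
  (is_first a, true, [ffun j => if j == k then b else digit a j]).

Definition walk di dw : prog cell := Prim (fun x _ a => Effect x a di dw None).
Definition home : prog cell :=
  Loop (fun _ _ a => ~~ is_first a) (walk Stay Left).
Definition set_flag b : prog cell :=
  Prim (fun _ _ a => Effect b a Stay Stay None).
Definition say s : prog cell :=
  Prim (fun x _ a => Effect x a Stay Stay (Some s)).
Definition say_digit k d : prog cell :=
  Prim (fun x _ a => Effect x a Stay d (Some (Digit (digit a k)))).

Definition sweep (b : bool -> cell -> bool) (f : bool -> cell -> bool * cell) :=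
  Seq (Loop (fun x _ a => b x a)
        (Prim (fun x _ a => let r := f x a in Effect r.1 r.2 Stay Right None)))
      home.

Definition clear k := sweep (fun _ a => is_used a)
  (fun x a => (x, set_digit a k false)).
Definition copy k l := sweep (fun _ a => is_used a)
  (fun x a => (x, set_digit a k (digit a l))).
Definition compare k l := Seq (set_flag true)
  (sweep (fun _ a => is_used a) (fun x a => (x && (digit a k == digit a l), a))).
(** The flag is the carry, initially 1. The sweep continues past the used part while a carry is
    pending, and [set_digit] marks the cell written there as used; this is how the width grows. *)
Definition incr k := Seq (set_flag true)
  (sweep (fun x a => is_used a || x)
    (fun x a => (x && digit a k, set_digit a k (digit a k (+) x)))).

(** From the far end of the used part the head comes back over leading zeros, but it stops at the
    units cell, whose digit is always printed; so 0 is printed as one digit. *)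
Definition print k :=
  Seq (Loop (fun _ _ a => is_used a) (walk Stay Right))
 (Seq (walk Stay Left)
 (Seq (Loop (fun _ _ a => ~~ is_first a && ~~ digit a k) (walk Stay Left))
 (Seq (Loop (fun _ _ a => ~~ is_first a) (say_digit k Left))
 (Seq (say_digit k Stay) (say EndVertex))))).

Definition unset : test cell := fun x _ _ => ~~ x.

Definition count_loop k l body :=
  Seq (clear k) (Seq (compare k l)
    (Loop unset (Seq body (Seq (incr k) (compare k l))))).

(** * Total correctness of the register operations *)

Variables (w : seq in_sym) (n L S : nat).
Hypotheses (lt_nL : n < 2 ^ L) (lt_LS : L < S).

Local Notation exec := (exec w S).

Definition tape_of wd (Q : K -> nat) : nat -> cell :=
  fun i => (i == 0, i < wd, [ffun k => odd (Q k %/ 2 ^ i)]).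

Definition fits wd (Q : K -> nat) := 0 < wd <= L /\ forall k, Q k < 2 ^ wd.

(** The width is quantified existentially because it depends on the past of the run, not only on the
    present values. [I] constrains the input head. *)
Definition stores_flag Q b (I : nat -> Prop) o (m : memory cell) :=
  exists wd i, [/\ fits wd Q, I i, i <= (size w).+1 & m = Memory b i (tape_of wd Q) 0 o].

Definition stores Q I o m := exists b, stores_flag Q b I o m.

Definition triple (P : memory cell -> Prop) p (P' : memory cell -> Prop) :=
  forall m, P m -> exists2 m', exec p m m' & P' m'.

Lemma triple_seq P1 P2 P3 p q :
  triple P1 p P2 -> triple P2 q P3 -> triple P1 (Seq p q) P3.
Proof.
move=> hp hq m /hp[m1 ex1 /hq[m2 ex2 P3m2]].
by exists m2 => //; apply: exec_seq ex1 ex2.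
Qed.

Lemma triple_weak P1 P1' P2 P2' p : (forall m, P1' m -> P1 m) ->
  (forall m, P2 m -> P2' m) -> triple P1 p P2 -> triple P1' p P2'.
Proof.
by move=> h1 h2 hp m /h1/hp[m1 ex1 /h2 P2m1]; exists m1.
Qed.

Lemma stores_flagW Q b I o m : stores_flag Q b I o m -> stores Q I o m.
Proof. by exists b. Qed.

Lemma stores_lt Q I o m : stores Q I o m -> wpos m < S.
Proof. by move=> [b [wd [i [_ _ _ ->]]]]; apply: leq_ltn_trans lt_LS. Qed.

(** Indexing the invariant by the round replaces a termination measure: the test first fails at
    index [l]. *)
Lemma triple_loop b p (P : nat -> memory cell -> Prop) l :
  (forall i m, i <= l -> P i m -> wpos m < S /\ holds w b m = (i < l)) ->
  (forall i, i < l -> triple (P i) p (P i.+1)) ->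
  triple (P 0) (Loop b p) (P l).
Proof.
move=> test_b hp.
suff H k : k <= l -> triple (P (l - k)) (Loop b p) (P l).
  by have := H l (leqnn l); rewrite subnn.
elim: k => [|k IHk] le_kl m.
  rewrite subn0 => Pm; have [lt_m b_m] := test_b _ _ (leqnn l) Pm.
  by exists m => //; apply: exec_exit; rewrite // b_m ltnn.
have lt_l : l - k.+1 < l by rewrite ltn_subrL (leq_trans _ le_kl).
move=> Pm; have [lt_m b_m] := test_b _ _ (ltnW lt_l) Pm.
have [m1 ex1] := hp _ lt_l _ Pm; rewrite subnSK // => /(IHk (ltnW le_kl)).
move=> [m2 ex2 Pm2]; exists m2 => //.
by apply: exec_iter ex1 ex2 => //; rewrite b_m.
Qed.

Lemma exec_loop b p (M : nat -> memory cell) l :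
  (forall i, i <= l -> wpos (M i) < S /\ holds w b (M i) = (i < l)) ->
  (forall i, i < l -> exec p (M i) (M i.+1)) ->
  exec (Loop b p) (M 0) (M l).
Proof.
move=> test_b hp; have [] := @triple_loop b p (fun i m => m = M i) l _ _ (M 0).
- by move=> i m le_il ->; apply: test_b.
- by move=> i lt_il m ->; exists (M i.+1) => //; apply: hp.
- by [].
by move=> m ex <-.
Qed.

Lemma exec_walk di dw m : wpos m < S ->
  exec (walk di dw) m (Memory (flag m) (move_in w di (ipos m)) (tape m)
    (move_head dw (wpos m)) (out m)).
Proof.
move=> lt_m; have := exec_prim w (fun x _ a => Effect x a di dw None) lt_m.
by rewrite /perform /= upd_id.
Qed.

Lemma exec_home x i T j o : j < S -> i <= (size w).+1 ->
  (forall j, is_first (T j) = (j == 0)) ->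
  exec home (Memory x i T j o) (Memory x i T 0 o).
Proof.
move=> lt_j le_i first_T; pose M k := Memory x i T (j - k) o.
suff: exec home (M 0) (M j) by rewrite /M subn0 subnn.
apply: exec_loop => k lt_kj.
  split; first exact: leq_ltn_trans (leq_subr _ _) lt_j.
  by rewrite /holds /= first_T subn_eq0 -ltnNge.
rewrite /M subnS; apply: exec_walk.
exact: leq_ltn_trans (leq_subr _ _) lt_j.
Qed.

(** A sweep acts as a finite automaton reading the cells from the left: [xs j] is the flag on
    arrival at cell [j], and [T'] is the rewritten tape. *)
Lemma exec_sweep (b : bool -> cell -> bool) (f : bool -> cell -> bool * cell)
    (xs : nat -> bool) (T T' : nat -> cell) l i o : l < S -> i <= (size w).+1 ->
  (forall j, j < l -> b (xs j) (T j) /\ f (xs j) (T j) = (xs j.+1, T' j)) ->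
  ~~ b (xs l) (T l) -> (forall j, l <= j -> T' j = T j) ->
  (forall j, is_first (T' j) = (j == 0)) ->
  exec (sweep b f) (Memory (xs 0) i T 0 o) (Memory (xs l) i T' 0 o).
Proof.
move=> lt_l le_i f_T nb_l T'E first_T'.
pose M k := Memory (xs k) i (fun j => if j < k then T' j else T j) k o.
apply: (@exec_seq _ _ _ _ _ _ (M l)); last first.
  rewrite {}/M (_ : (fun j => _) = T'); first exact: exec_home.
  by apply: functional_extensionality => j; case: leqP => // /T'E->.
have -> : Memory (xs 0) i T 0 o = M 0 by [].
apply: exec_loop => k le_kl.
  split; first exact: leq_ltn_trans lt_l.
  rewrite /holds /= ltnn; move: le_kl; rewrite leq_eqVlt.
  by case: eqP => [-> _|_ /= lt_kl]; rewrite ?ltnn ?(negPf nb_l) // (f_T k _).1.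
have lt_kS : wpos (M k) < S by apply: leq_ltn_trans lt_l; apply: ltnW.
have := exec_prim w (fun x _ a => let r := f x a in Effect r.1 r.2 Stay Right None) lt_kS.
rewrite /perform /= ltnn (f_T k le_kl).2 /=.
suff -> : upd (fun j => if j < k then T' j else T j) k (T' k) =
    (fun j => if j < k.+1 then T' j else T j) by [].
apply: functional_extensionality => j.
by rewrite /upd ltnS; case: ltngtP => [||->].
Qed.

Lemma digitE wd Q i k : digit (tape_of wd Q i) k = odd (Q k %/ 2 ^ i).
Proof. by rewrite /digit ffunE. Qed.

Lemma set_digitE wd wd' Q i k a : i < wd' ->
  set_digit (tape_of wd Q i) k (odd (a %/ 2 ^ i)) = tape_of wd' (upd Q k a) i.
Proof.
move=> lt_i; rewrite /set_digit /tape_of lt_i; congr (_, _, _).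
by apply/ffunP=> j; rewrite !ffunE /upd /=; case: ifP => // _; rewrite digitE.
Qed.

Lemma tape_of_beyond wd Q i : fits wd Q -> wd <= i ->
  tape_of wd Q i = (false, false, [ffun=> false]).
Proof.
move=> [/andP[wd_gt0 _] lt_Q] le_wd; rewrite /tape_of ltnNge le_wd.
rewrite (gtn_eqF (leq_trans wd_gt0 le_wd)); congr (_, _, _).
apply/ffunP=> k; rewrite !ffunE divn_small //.
by rewrite (leq_trans (lt_Q k)) // leq_exp2l.
Qed.

Lemma fits_upd wd Q k a : fits wd Q -> a < 2 ^ wd -> fits wd (upd Q k a).
Proof. by move=> [? lt_Q] lt_a; split=> // j; rewrite /upd; case: eqP. Qed.

Lemma fits_lt wd Q : fits wd Q -> wd < S.
Proof. by move=> [/andP[_ le_wd] _]; apply: leq_ltn_trans lt_LS. Qed.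

(** Some register already holds a value at least [a], so [a] fits into the present width and no cell
    has to be added. *)
Lemma triple_write f k a Q I o :
  (forall x wd i,
    f x (tape_of wd Q i) = (x, set_digit (tape_of wd Q i) k (odd (a %/ 2 ^ i)))) ->
  (exists j, a <= Q j) ->
  triple (stores Q I o) (sweep (fun _ a => is_used a) f) (stores (upd Q k a) I o).
Proof.
move=> fE [j le_a] m [b [wd [i [fit_Q Ii le_i ->]]]].
have fit' : fits wd (upd Q k a).
  by apply: fits_upd => //; case: fit_Q => _ /(_ j); apply: leq_ltn_trans.
exists (Memory b i (tape_of wd (upd Q k a)) 0 o); last first.
  by exists b, wd, i.
apply: (@exec_sweep _ _ (fun=> b) _ _ wd) => //.
- exact: fits_lt fit_Q.
- move=> l lt_l; split=> //.
  by rewrite fE (set_digitE wd _ _ _ lt_l).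
- by rewrite /is_used /= ltnn.
- by move=> l le_l; rewrite !tape_of_beyond.
Qed.

Lemma triple_clear k Q I o :
  triple (stores Q I o) (clear k) (stores (upd Q k 0) I o).
Proof.
apply: triple_write; last by exists k.
by move=> x wd i; rewrite div0n.
Qed.

Lemma triple_copy k l Q I o :
  triple (stores Q I o) (copy k l) (stores (upd Q k (Q l)) I o).
Proof.
apply: triple_write; last by exists l.
by move=> x wd i; rewrite digitE.
Qed.

Lemma exec_set_flag b m : wpos m < S ->
  exec (set_flag b) m (Memory b (ipos m) (tape m) (wpos m) (out m)).
Proof.
move=> lt_m; have := exec_prim w (fun _ _ a => Effect b a Stay Stay None) lt_m.
by rewrite /perform /= upd_id.
Qed.

Lemma triple_compare k l Q I o :
  triple (stores Q I o) (compare k l) (stores_flag Q (Q k == Q l) I o).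
Proof.
move=> m [b [wd [i [fit_Q Ii le_i ->]]]].
exists (Memory (Q k == Q l) i (tape_of wd Q) 0 o); last by exists wd, i.
apply: exec_seq.
  by apply: exec_set_flag; apply: leq_ltn_trans lt_LS.
rewrite /=.
pose xs j := all (fun i => odd (Q k %/ 2 ^ i) == odd (Q l %/ 2 ^ i)) (iota 0 j).
have -> : (Q k == Q l) = xs wd.
  apply/eqP/allP => [-> //|eqQ].
  case: fit_Q => _ lt_Q; apply: digits_inj (lt_Q k) (lt_Q l) _ => j lt_j.
  by apply/eqP; apply: eqQ; rewrite mem_iota.
apply: (exec_sweep (xs := xs) (l := wd)) => //.
- exact: fits_lt fit_Q.
- move=> j lt_j; split=> //; congr (_, _).
  by rewrite /xs -[j.+1]addn1 iotaD all_cat /= andbT !digitE.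
- by rewrite /is_used /= ltnn.
Qed.

Lemma triple_incr k Q I o : Q k < n ->
  triple (stores Q I o) (incr k) (stores (upd Q k (Q k).+1) I o).
Proof.
move=> lt_n m [b [wd [i [fit_Q Ii le_i ->]]]].
have [wd_le lt_Q] := fit_Q.
(* [xs j] is the carry into digit [j]; the width grows by one exactly when the carry leaves the used
   part. *)
pose xs j := 2 ^ j %| (Q k).+1; pose wd' := wd + xs wd.
have QkE : xs wd -> (Q k).+1 = 2 ^ wd.
  by move=> dvd_wd; apply/eqP; rewrite eqn_leq lt_Q dvdn_leq.
(* A carry out of the used part means that the new value is [2 ^ wd]; it is at most [n], hence below
   [2 ^ L]. *)
have le_L : wd' <= L.
  rewrite /wd'; case: (boolP (xs wd)) => [/QkE E|_]; last first.
    by rewrite addn0; case/andP: wd_le.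
  by rewrite addn1 -(ltn_exp2l _ _ (isT : 1 < 2)) -E (leq_ltn_trans lt_n).
have fit' : fits wd' (upd Q k (Q k).+1).
  split=> [|j]; first by rewrite le_L andbT ltn_addr //; case/andP: wd_le.
  have le_wd : 2 ^ wd <= 2 ^ wd' by rewrite leq_exp2l // leq_addr.
  rewrite /upd; case: (j == k); last exact: leq_trans le_wd.
  rewrite /wd'; case: (boolP (xs wd)) => [/QkE->|ndvd].
    by rewrite ltn_exp2l // addn1.
  rewrite addn0 ltn_neqAle lt_Q andbT; apply: contraNneq ndvd => E.
  by rewrite /xs E.
exists (Memory false i (tape_of wd' (upd Q k (Q k).+1)) 0 o); last first.
  by exists false, wd', i.
apply: exec_seq.
  by apply: exec_set_flag; apply: leq_ltn_trans lt_LS.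
rewrite /=.
have xs_wd' : xs wd' = false.
  rewrite /wd'; case: (boolP (xs wd)) => [dvd_wd|/negPf]; last by rewrite addn0.
  rewrite addn1 /xs dvd_carry divn_small ?andbF //.
have -> : true = xs 0 by rewrite /xs dvd1n.
rewrite -[in X in exec _ _ X]xs_wd'.
apply: (exec_sweep (xs := xs) (l := wd')) => //.
- exact: leq_ltn_trans lt_LS.
- move=> j lt_j; split.
    rewrite /is_used /=; case: leqP => //= le_j.
    have dvd_wd : xs wd.
      by move: lt_j; rewrite /wd'; case: (xs wd); rewrite // addn0 ltnNge le_j.
    suff -> : j = wd by [].
    apply/eqP; rewrite eqn_leq le_j andbT -ltnS; move: lt_j.
    by rewrite /wd' dvd_wd addn1.
  by rewrite digitE -odd_divS (set_digitE _ _ _ _ lt_j) /xs dvd_carry.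
- by rewrite xs_wd' orbF /is_used /= -leqNgt leq_addr.
- move=> j le_j; rewrite !tape_of_beyond //.
  by rewrite (leq_trans _ le_j) // leq_addr.
Qed.

Lemma exec_say_digit k d m : wpos m < S ->
  exec (say_digit k d) m (Memory (flag m) (ipos m) (tape m) (move_head d (wpos m))
    (rcons (out m) (Digit (digit (tape m (wpos m)) k)))).
Proof.
move=> lt_m.
have := exec_prim w (fun x _ a => Effect x a Stay d (Some (Digit (digit a k)))) lt_m.
by rewrite /perform /= upd_id.
Qed.

Lemma exec_say s m : wpos m < S -> exec (say s) m
  (Memory (flag m) (ipos m) (tape m) (wpos m) (rcons (out m) s)).
Proof.
move=> lt_m; have := exec_prim w (fun x _ a => Effect x a Stay Stay (Some s)) lt_m.
by rewrite /perform /= upd_id.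
Qed.

Lemma triple_say s Q I o :
  triple (stores Q I o) (say s) (stores Q I (rcons o s)).
Proof.
move=> m [b [wd [i [fit_Q Ii le_i ->]]]].
exists (Memory b i (tape_of wd Q) 0 (rcons o s)); last by exists b, wd, i.
by apply: exec_say; apply: leq_ltn_trans lt_LS.
Qed.

Lemma rev_iotaS m j : rev (iota m j.+1) = m + j :: rev (iota m j).
Proof. by rewrite -[j.+1]addn1 iotaD rev_cat. Qed.

Lemma triple_print k Q I o : triple (stores Q I o) (print k)
  (stores Q I (o ++ rcons [seq Digit b | b <- binary (Q k)] EndVertex)).
Proof.
move=> m [b [wd [i [fit_Q Ii le_i ->]]]]; set o' := o ++ _.
exists (Memory b i (tape_of wd Q) 0 o'); last by exists b, wd, i.
have lt_S j : j <= wd -> j < S.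
  by move=> le_j; apply: leq_ltn_trans le_j (fits_lt fit_Q).
have [/andP[wd_gt0 _] lt_Q] := fit_Q.
pose M j o := Memory b i (tape_of wd Q) j o; rewrite -!/(M _ _).
(* The position of the leading digit, or 0 for the value 0. *)
pose t := trunc_log 2 (Q k).
have lt_t : t < wd.
  rewrite /t; have [->|Qk_gt0] := posnP (Q k); first by rewrite trunc_log0.
  have /andP[le_Q _] := trunc_log_bounds (isT : 1 < 2) Qk_gt0.
  by rewrite -(ltn_exp2l _ _ (isT : 1 < 2)) (leq_ltn_trans le_Q).
have le_t : t <= wd.-1 by rewrite -ltnS prednK.
apply: (@exec_seq _ _ _ _ _ _ (M wd o)).
  apply: (exec_loop (M := fun j => M j o)) => j le_j.
    by split; [exact: lt_S | rewrite /holds /is_used].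
  by apply: exec_walk; apply: lt_S; apply: ltnW.
apply: (@exec_seq _ _ _ _ _ _ (M wd.-1 o)).
  by apply: exec_walk; apply: lt_S.
apply: (@exec_seq _ _ _ _ _ _ (M t o)).
  suff: exec (Loop (fun _ _ a => ~~ is_first a && ~~ digit a k) (walk Stay Left))
      (M (wd.-1 - 0) o) (M (wd.-1 - (wd.-1 - t)) o).
    by rewrite subn0 subKn.
  apply: (exec_loop (M := fun j => M (wd.-1 - j) o)) => j.
    move=> le_j; split.
      by apply: lt_S; apply: leq_trans (leq_subr _ _) (leq_pred _).
    rewrite /holds /= digitE /is_first /=.
    move: le_j; rewrite leq_eqVlt; case: eqVneq => [-> _ | _ /= lt_j].
      rewrite ltnn subKn //; have [//|t_gt0] := posnP t.
      have Qk_gt0 : 0 < Q k.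
        by move: t_gt0; rewrite /t; case: (Q k); rewrite ?trunc_log0.
      have /andP[le_Q lt_QS] := trunc_log_bounds (isT : 1 < 2) Qk_gt0.
      suff -> : Q k %/ 2 ^ t = 1 by [].
      apply/eqP; rewrite eqn_leq leq_divRL ?expn_gt0 // mul1n le_Q andbT.
      by rewrite -ltnS ltn_divLR ?expn_gt0 // -expnS.
    have lt_tj : t < wd.-1 - j by rewrite ltn_subCr.
    rewrite lt_j gtn_eqF ?(leq_ltn_trans _ lt_tj) //= divn_small //.
    by apply: leq_trans (trunc_log_ltn _ (isT : 1 < 2)) _; rewrite leq_exp2l.
  move=> lt_j; rewrite subnS; apply: exec_walk.
  by apply: lt_S; apply: leq_trans (leq_subr _ _) (leq_pred _).
pose D i := Digit (odd (Q k %/ 2 ^ i)).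
apply: (@exec_seq _ _ _ _ _ _ (M 0 (o ++ map D (rev (iota 1 t))))).
  elim: t o lt_t {le_t o'} => [|t IHt] o lt_t.
    by rewrite cats0; apply: exec_exit; rewrite // lt_S.
  apply: (@exec_iter _ _ _ _ _ _ (M t (rcons o (D t.+1)))) => //.
  - by apply/lt_S/ltnW.
  - have -> : D t.+1 = Digit (digit (tape_of wd Q t.+1) k) by rewrite digitE.
    by apply: exec_say_digit; apply/lt_S/ltnW.
  by rewrite rev_iotaS add1n /= -cat_rcons; apply: IHt; apply: ltnW.
have -> : o' = rcons (rcons (o ++ map D (rev (iota 1 t))) (D 0)) EndVertex.
  rewrite /o' /binary -/t -map_comp -!rcons_cat; congr rcons.
  rewrite -cats1 -catA; congr (_ ++ _).
  by rewrite -[t.+1]add1n iotaD rev_cat map_cat.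
apply: exec_seq.
  by apply: exec_say_digit; apply: lt_S.
rewrite /= digitE; apply: exec_say; exact: lt_S.
Qed.

(** [Q'] describes the registers after the body and before the increment: the body has to leave the
    counter at [i]. The limit register holds [l] at the start of every round. *)
Lemma triple_count_loop (Qs : nat -> K -> nat) (Is : nat -> nat -> Prop) os l
    k k' body Q : l <= n -> upd Q k 0 = Qs 0 ->
  (forall i, i <= l -> Qs i k = i /\ Qs i k' = l) ->
  (forall i, i < l -> exists Q', [/\ Q' k = i, upd Q' k i.+1 = Qs i.+1 &
    triple (stores (Qs i) (Is i) (os i)) body
           (stores Q' (Is i.+1) (os i.+1))]) ->
  triple (stores Q (Is 0) (os 0)) (count_loop k k' body)
         (stores (Qs l) (Is l) (os l)).
Proof.
move=> le_n Q0 QsE bodyP.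
have cmpP i : i <= l -> triple (stores (Qs i) (Is i) (os i)) (compare k k')
    (stores_flag (Qs i) (i == l) (Is i) (os i)).
  move=> /QsE[Ek Ek'].
  by have := @triple_compare k k' (Qs i) (Is i) (os i); rewrite Ek Ek'.
apply: triple_seq; first exact: triple_clear.
rewrite Q0; apply: triple_seq; first exact: cmpP.
pose P i := stores_flag (Qs i) (i == l) (Is i) (os i).
apply: (triple_weak (P1 := P 0) (P2 := P l)) => // [m|].
  exact: stores_flagW.
apply: triple_loop => [i m le_i Pm|i lt_i].
  split; first exact: stores_lt (stores_flagW Pm).
  case: Pm => [wd [j [_ _ _ ->]]].
  by rewrite /holds /unset /= ltn_neqAle le_i andbT.
have [Q' [Q'k Q'E bodyi]] := bodyP i lt_i.
apply: (triple_weak (P1 := stores (Qs i) (Is i) (os i)) (P2 := P i.+1)) => //.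
  by move=> m; apply: stores_flagW.
apply: triple_seq bodyi _; apply: triple_seq; last exact: cmpP.
have := @triple_incr k Q' (Is i.+1) (os i.+1).
by rewrite Q'k Q'E; apply; apply: leq_trans le_n.
Qed.

Lemma triple_input p b b' i i' Q o : i' <= (size w).+1 ->
  (forall T, exec p (Memory b i T 0 o) (Memory b' i' T 0 o)) ->
  triple (stores_flag Q b (eq i) o) p (stores_flag Q b' (eq i') o).
Proof.
move=> le_i' ex m [wd [j [fit_Q <- le_i ->]]].
by exists (Memory b' i' (tape_of wd Q) 0 o) => //; exists wd, i'.
Qed.

End Registers.

(** * Reading the adjacency matrix *)

Lemma nth_flatten_rows (A : Type) (x : A) l (ss : seq (seq A)) i j :
  all (fun s => size s == l) ss -> j < l ->
  nth x (flatten ss) (i * l + j) = nth x (nth [::] ss i) j.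
Proof.
elim: ss i => [|s ss IHss] [|i] //=; rewrite ?nth_nil //.
  by move=> /andP[/eqP sz_s _] lt_j; rewrite nth_cat sz_s lt_j.
move=> /andP[/eqP sz_s sz_ss] lt_j.
by rewrite nth_cat sz_s mulSn -addnA ltnNge leq_addr /= addKn IHss.
Qed.

Section Input.
Variables (n : nat) (e : rel 'I_n).
Local Notation w := (graph_code e).

(** Extended by false to all natural numbers, so that it is also defined at the value [n]. *)
Definition adjacency i j :=
  if (insub i, insub j) is (Some i', Some j') then e i' j' else false.

(** A row takes [n.+1] cells because of its [EndRow], and the outer successor skips the left end
    marker. [row_start n] is the position of the right end marker. *)
Definition row_start i := (i * n.+1).+1.

Lemma size_graph_code : size w = n * n.+1.
Proof.
rewrite size_flatten /shape -map_comp sumnE big_map big_enum /=.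
rewrite (eq_bigr (fun=> n.+1)) ?sum_nat_const ?card_ord // => i _.
by rewrite size_rcons size_map size_enum_ord.
Qed.

Lemma row_start_le i : i <= n -> row_start i <= (size w).+1.
Proof. by move=> le_i; rewrite size_graph_code ltnS leq_mul2r le_i orbT. Qed.

Lemma read_row i j (lt_i : i < n) : j < n.+1 -> in_read w (row_start i + j) =
  if insub j is Some j' then Sym (Entry (e (Ordinal lt_i) j')) else Sym EndRow.
Proof.
move=> lt_j; rewrite /in_read addSn /=.
rewrite (nth_map EndRow); last first.
  rewrite size_graph_code; apply: leq_trans (_ : i.+1 * n.+1 <= _).
    by rewrite mulSn addnC ltn_add2r.
  by rewrite leq_mul2r lt_i orbT.
rewrite nth_flatten_rows //; last first.
  by rewrite all_map; apply/allP=> s _; rewrite /= size_rcons size_map size_enum_ord.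
rewrite (nth_map (Ordinal lt_i)) ?size_enum_ord //.
rewrite (_ : nth _ _ i = Ordinal lt_i); last by apply: val_inj; rewrite /= nth_enum_ord.
rewrite nth_rcons size_map size_enum_ord.
case: insubP => [j' lt_jn j'E|]; last by move/negPf->; rewrite if_same.
rewrite lt_jn (nth_map j') ?size_enum_ord //; congr (Sym (Entry (e _ _))).
by apply: val_inj; rewrite j'E /= nth_enum_ord.
Qed.

Lemma read_beyond i : size w < i -> in_read w i = RightEnd.
Proof. by case: i => // i lt_i; rewrite /in_read /= nth_default ?size_map. Qed.

Lemma read_start i : 0 < i -> in_read w i <> LeftEnd.
Proof.
case: i => // i _; rewrite /in_read /=.
by elim: w i => [|a s IHs] [|i] //=; apply: IHs.
Qed.

(** For [i = n] the truncated position is the right end marker, and for [j = n] with [i < n] the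
    symbol read is [EndRow]; both count as no arc. *)
Lemma read_edge i j : i <= n -> j <= n ->
  (if in_read w (minn (row_start i + j) (size w).+1) is Sym (Entry b) then b
   else false) = adjacency i j.
Proof.
move=> le_i le_j; rewrite /adjacency.
case: (insubP _ i) => [i' lt_i i'E|]; last first.
  rewrite -leqNgt => ge_i; rewrite read_beyond // leq_min ltnSn andbT.
  rewrite size_graph_code /row_start addSn ltnS.
  by rewrite (leq_trans _ (leq_addr _ _)) // leq_mul2r ge_i orbT.
rewrite (minn_idPl _); last first.
  rewrite size_graph_code addSn ltnS (leq_trans (_ : _ <= i.+1 * n.+1)) //.
    by rewrite mulSn addnC leq_add2r ltnW.
  by rewrite leq_mul2r lt_i orbT.
rewrite (read_row lt_i) ?ltnS //; case: insubP => // j' _ _.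
by congr e; apply: val_inj.
Qed.

Variable K : finType.
Variables (L S : nat).
Hypotheses (lt_nL : n < 2 ^ L) (lt_LS : L < S).

Local Notation exec := (exec w S).
Local Notation stores := (@stores K w L).
Local Notation stores_flag := (@stores_flag K w L).
Local Notation triple := (@triple K w S).

Definition at_end_row (x : bool) c (a : cell K) :=
  if c is Sym EndRow then true else false.
Definition at_left (x : bool) c (a : cell K) :=
  if c is LeftEnd then true else false.
Definition at_right (x : bool) c (a : cell K) :=
  if c is RightEnd then true else false.

Definition rewind : prog (cell K) :=
  Loop (fun x c a => ~~ at_left x c a) (walk K Left Stay).
Definition skip_row : prog (cell K) :=
  Seq (Loop (fun x c a => ~~ at_end_row x c a) (walk K Right Stay))
      (walk K Right Stay).

Lemma exec_rewind b i T o : exec rewind (Memory b i T 0 o) (Memory b 0 T 0 o).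
Proof.
pose M k := Memory b (i - k) T 0 o.
suff: exec rewind (M 0) (M i) by rewrite /M subn0 subnn.
apply: exec_loop => k le_k.
  split; first exact: leq_ltn_trans lt_LS.
  rewrite /holds /at_left /=; case: ltnP => [lt_k|].
    by case: (in_read _ _) (@read_start (i - k)) => //; rewrite subn_gt0 => /(_ lt_k).
  by rewrite -subn_eq0 => /eqP->.
rewrite /M subnS; apply: (@exec_walk K w S Left Stay (Memory b (i - k) T 0 o)).
exact: leq_ltn_trans lt_LS.
Qed.

Lemma exec_skip_row b i T o : i < n ->
  exec skip_row (Memory b (row_start i) T 0 o) (Memory b (row_start i.+1) T 0 o).
Proof.
move=> lt_i; pose M k := Memory b (row_start i + k) T 0 o.
have le_w k : k <= n.+1 -> row_start i + k <= (size w).+1.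
  move=> le_k; apply: leq_trans (row_start_le lt_i).
  by rewrite addSn ltnS mulSn addnC leq_add2r.
apply: (@exec_seq _ _ _ _ _ _ (M n)).
  suff: exec (Loop (fun x c a => ~~ at_end_row x c a) (walk K Right Stay)) (M 0) (M n).
    by rewrite {1}/M addn0.
  apply: exec_loop => k le_k.
    split; first exact: leq_ltn_trans lt_LS.
    rewrite /holds (read_row lt_i) ?ltnS //.
    by case: insubP => [? -> _|/negPf->].
  have := @exec_walk K w S Right Stay (M k).
  rewrite /= (minn_idPl _) -?addnS ?le_w ?ltnS //.
    by apply; apply: leq_ltn_trans lt_LS.
  by rewrite ltnW.
have := @exec_walk K w S Right Stay (M n).
rewrite /= (minn_idPl _) -?addnS ?le_w // /row_start.
rewrite (_ : (i.+1 * n.+1).+1 = (i * n.+1).+1 + n.+1); last by rewrite addSn mulSn addnC.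
by apply; apply: leq_ltn_trans lt_LS.
Qed.

Definition test_edge (x : bool) c (a : cell K) :=
  if c is Sym (Entry b) then b else false.

Definition read_edge_to_flag : prog (cell K) :=
  Prim (fun x c a => Effect (test_edge x c a) a Stay Stay None).

(* The register [t] is scratch space and is expected to be 0. *)
Definition find_edge t k l :=
  Seq rewind (Seq (walk K Right Stay)
    (Seq (count_loop t k skip_row) (Seq (count_loop t l (walk K Right Stay))
      (Seq (clear t) read_edge_to_flag)))).

Definition boot : prog (cell K) :=
  Prim (fun x _ _ => Effect x (true, true, [ffun=> false]) Right Stay None).

Definition read_size k :=
  Loop (fun x c a => ~~ at_right x c a) (Seq skip_row (incr k)).

Lemma triple_move p i i' Q o : i' <= (size w).+1 ->
  (forall b T, exec p (Memory b i T 0 o) (Memory b i' T 0 o)) ->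
  triple (stores Q (eq i) o) p (stores Q (eq i') o).
Proof.
move=> le_i' ex m [b Qm].
have [//|m' ex' Qm'] := @triple_input _ w L S p b b i i' Q o le_i' _ m Qm.
by exists m' => //; exists b.
Qed.

Lemma triple_find_edge t k l Q I o : k != t -> l != t -> Q t = 0 ->
  Q k <= n -> Q l <= n ->
  triple (stores Q I o) (find_edge t k l)
    (stores_flag Q (adjacency (Q k) (Q l)) (fun=> True) o).
Proof.
move=> neq_k neq_l Qt0 le_k le_l.
have updE j i : j != t -> upd Q t i j = Q j by rewrite /upd => /negPf->.
apply: (triple_seq (P2 := stores Q (eq 0) o)).
  move=> m [b [wd [i [fit_Q _ _ ->]]]]; exists (Memory b 0 (tape_of wd Q) 0 o).
    exact: exec_rewind.
  by exists b, wd, 0.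
apply: (triple_seq (P2 := stores Q (eq (row_start 0)) o)).
  apply: triple_move => [|b T]; first exact: row_start_le.
  have := @exec_walk K w S Right Stay (Memory b 0 T 0 o).
  by rewrite /= (minn_idPl _) //; apply; apply: leq_ltn_trans lt_LS.
apply: triple_seq.
  apply: (triple_count_loop lt_nL lt_LS (Qs := upd Q t)
    (Is := fun i => eq (row_start i)) (os := fun=> o) le_k) => // i.
    by rewrite upd_same updE.
  move=> lt_i; exists (upd Q t i); rewrite upd_same upd_upd; split=> //.
  apply: triple_move => [|b T]; first by apply/row_start_le/(leq_trans lt_i).
  by apply: exec_skip_row; apply: leq_trans le_k.
(* [Q k] may be [n]; the head then starts at the right end marker and stays there, hence the
   truncation. *)
pose col i := minn (row_start (Q k) + i) (size w).+1.
have -> : row_start (Q k) = col 0.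
  by rewrite /col addn0 (minn_idPl _) // row_start_le.
apply: triple_seq.
  apply: (triple_count_loop lt_nL lt_LS (Qs := upd Q t)
    (Is := fun i => eq (col i)) (os := fun=> o) le_l).
  - by rewrite upd_upd.
  - by move=> i; rewrite upd_same updE.
  move=> i lt_i; exists (upd Q t i); rewrite upd_same upd_upd; split=> //.
  apply: triple_move => [|b T]; first exact: geq_minr.
  have := @exec_walk K w S Right Stay (Memory b (col i) T 0 o).
  rewrite /= [minn (col i).+1 _](_ : _ = col i.+1).
    by apply; apply: leq_ltn_trans lt_LS.
  by rewrite /col addnS -minnSS -minnA; congr minn; apply/minn_idPr.
apply: triple_seq.
  exact: (triple_clear lt_LS).
(* The scratch register was 0 at the beginning, so clearing it restores [Q]. *)
rewrite upd_upd -[in upd _ _ _]Qt0 upd_id => m [b [wd [i [fit_Q <- _ ->]]]].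
exists (Memory (adjacency (Q k) (Q l)) (col (Q l)) (tape_of wd Q) 0 o); last first.
  by exists wd, (col (Q l)); split=> //; apply: geq_minr.
have := exec_prim w (fun x c a => Effect (test_edge x c a) a Stay Stay None)
  (leq_ltn_trans (leq0n L) lt_LS : wpos (Memory b (col (Q l)) (tape_of wd Q) 0 o) < S).
by rewrite /perform /= upd_id /test_edge read_edge.
Qed.

Lemma triple_read_size k :
  triple (stores (fun=> 0) (eq 1) [::]) (read_size k)
         (stores (upd (fun=> 0) k n) (eq (row_start n)) [::]).
Proof.
have -> : (fun=> 0) = upd (fun=> 0) k 0 :> (K -> nat) by rewrite (upd_id (fun=> 0)).
pose P i := stores (upd (fun=> 0) k i) (eq (row_start i)) [::].
rewrite upd_upd; apply: (triple_loop (P := P)) => [i m le_i Pm|i lt_i].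
  split; first exact: stores_lt Pm.
  case: Pm => [b [wd [j [_ <- _ ->]]]].
  rewrite /holds /at_right /=; move: le_i; rewrite leq_eqVlt.
  case: eqVneq => [-> _|_ /= lt_i].
    by rewrite read_beyond ?ltnn // size_graph_code.
  by have := read_row lt_i (ltn0Sn n); rewrite addn0 => ->; case: insubP.
apply: (triple_seq (P2 := stores (upd (fun=> 0) k i) (eq (row_start i.+1)) [::])).
  apply: triple_move => [|b T]; [exact: row_start_le|exact: exec_skip_row].
have := @triple_incr K w n L S lt_nL lt_LS k (upd (fun=> 0) k i).
by rewrite /P upd_same upd_upd; apply.
Qed.

Lemma exec_boot : 0 < L -> exists2 m,
  exec boot (Memory false 0 (fun=> (false, false, [ffun=> false])) 0 [::]) m &
  stores (fun=> 0) (eq 1) [::] m.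
Proof.
move=> L_gt0; exists (Memory false 1 (tape_of 1 (fun=> 0)) 0 [::]).
  have := exec_prim w (fun x _ (_ : cell K) =>
    Effect x ((true, true, [ffun=> false]) : cell K) Right Stay None)
    (leq_ltn_trans (leq0n L) lt_LS : wpos (Memory false 0
      (fun=> (false, false, [ffun=> false]) : cell K) 0 [::]) < S).
  rewrite /perform /= (minn_idPl _) //.
  rewrite (_ : upd _ _ _ = tape_of 1 (fun=> 0)) //.
  apply: functional_extensionality => -[|i]; rewrite /upd /tape_of /=;
  by congr (_, _, _); apply/ffunP=> j; rewrite !ffunE div0n.
by exists false, 1, 1; split=> //; split.
Qed.

End Input.

(** * A loop language over the vertices of a graph *)

Section Language.
Variable V : finType.

(* As an operand, [None] is the number [n] of vertices. [Incr] saturates at [n]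
   and [For] binds its variable to 0, ..., n-1, so that registers never exceed
   [n] and all commands terminate. *)
Inductive cmd :=
| Nop
| Set_ of V & option V
| Zero of V
| Incr of V
| IfEq of option V & option V & cmd & cmd
| IfEdge of V & V & cmd & cmd
| For of V & cmd
| Print of V
| PrintEnd
| Then of cmd & cmd.

Definition store := ((V -> nat) * seq out_sym)%type.

Definition operand n (R : V -> nat) s := if s is Some v then R v else n.

Section Semantics.
Variables (n : nat) (edge : nat -> nat -> bool).

(** [For] leaves [n] in its variable because the compiled loop exits when its counter equals [n]. *)
Fixpoint sem c (s : store) : store :=
  match c with
  | Nop => s
  | Set_ v a => (upd s.1 v (operand n s.1 a), s.2)
  | Zero v => (upd s.1 v 0, s.2)
  | Incr v => (if s.1 v == n then s.1 else upd s.1 v (s.1 v).+1, s.2)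
  | IfEq a b c1 c2 =>
      if operand n s.1 a == operand n s.1 b then sem c1 s else sem c2 s
  | IfEdge u v c1 c2 => if edge (s.1 u) (s.1 v) then sem c1 s else sem c2 s
  | For v c =>
      let s' := iteri n (fun i s => sem c (upd s.1 v i, s.2)) s in
      (upd s'.1 v n, s'.2)
  | Print v =>
      (s.1, s.2 ++ rcons [seq Digit b | b <- binary (s.1 v)] EndVertex)
  | PrintEnd => (s.1, rcons s.2 EndPath)
  | Then c1 c2 => sem c2 (sem c1 s)
  end.

Fixpoint writes c v :=
  match c with
  | Set_ u _ | Zero u | Incr u => v == u
  | IfEq _ _ c1 c2 | IfEdge _ _ c1 c2 | Then c1 c2 => writes c1 v || writes c2 v
  | For u c => (v == u) || writes c v
  | _ => false
  end.

(** A body must not write its own loop variable: [sem] sets the variable afresh in every round,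
    whereas the compiled loop increments the register it finds. *)
Fixpoint well_formed c :=
  match c with
  | IfEq _ _ c1 c2 | IfEdge _ _ c1 c2 | Then c1 c2 =>
      well_formed c1 && well_formed c2
  | For u c => ~~ writes c u && well_formed c
  | _ => true
  end.

Lemma sem_frame c v s : ~~ writes c v -> (sem c s).1 v = s.1 v.
Proof.
have updE (R : V -> nat) u a : v != u -> upd R u a v = R v.
  by rewrite /upd => /negPf->.
elim: c s => //=.
- by move=> u a s; apply: updE.
- by move=> u s; apply: updE.
- by move=> u s; case: ifP => // _; apply: updE.
- move=> a b c1 IH1 c2 IH2 s; rewrite negb_or => /andP[/IH1 E1 /IH2 E2].
  by case: ifP.
- move=> a b c1 IH1 c2 IH2 s; rewrite negb_or => /andP[/IH1 E1 /IH2 E2].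
  by case: ifP.
- move=> u c IH s; rewrite negb_or => /andP[neq_v /IH E].
  rewrite updE //; elim: n => //= i IHi.
  by rewrite E /= updE.
- move=> c1 IH1 c2 IH2 s; rewrite negb_or => /andP[/IH1 E1 /IH2 E2].
  by rewrite E2.
Qed.

Definition bounded (s : store) := forall v, s.1 v <= n.

Lemma bounded_upd s v a o : bounded s -> a <= n -> bounded (upd s.1 v a, o).
Proof. by move=> bs le_a u; rewrite /= /upd; case: eqP. Qed.

Lemma bounded_operand s a : bounded s -> operand n s.1 a <= n.
Proof. by case: a => [v|] /=; auto. Qed.

Lemma bounded_sem c s : bounded s -> bounded (sem c s).
Proof.
elim: c s => //=.
- by move=> v a s bs; apply: bounded_upd => //; apply: bounded_operand.
- by move=> v s bs; apply: bounded_upd.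
- move=> v s bs; case: eqVneq => [_ u|neq]; first exact: bs.
  by apply: bounded_upd => //; rewrite ltn_neqAle neq bs.
- by move=> a b c1 IH1 c2 IH2 s bs; case: ifP => _; auto.
- by move=> a b c1 IH1 c2 IH2 s bs; case: ifP => _; auto.
- move=> v c IH s bs; apply: bounded_upd (leqnn n).
  have: forall i, i <= n ->
    bounded (iteri i (fun i s => sem c (upd s.1 v i, s.2)) s).
    by elim=> //= i IHi lt_i; apply/IH/bounded_upd/ltnW => //; apply/IHi/ltnW.
  exact.
- by move=> c1 IH1 c2 IH2 s bs; auto.
Qed.

End Semantics.

(* The outer [None] is a scratch register; [Some None] holds [n]. *)
Definition reg : finType := option (option V).
Definition scratch : reg := None.
Definition size_reg : reg := Some None.
Definition reg_of (a : option V) : reg := Some a.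
Definition var (v : V) : reg := Some (Some v).

Definition if_flag p q : prog (cell reg) := Ite (fun x _ _ => x) p q.

Definition nop : prog (cell reg) := Prim (fun x _ a => idle x a).

Fixpoint comp c : prog (cell reg) :=
  match c with
  | Nop => nop
  | Set_ v a => copy (var v) (reg_of a)
  | Zero v => clear (var v)
  | Incr v => Seq (compare (var v) size_reg) (if_flag nop (incr (var v)))
  | IfEq a b c1 c2 =>
      Seq (compare (reg_of a) (reg_of b)) (if_flag (comp c1) (comp c2))
  | IfEdge u v c1 c2 =>
      Seq (find_edge scratch (var u) (var v)) (if_flag (comp c1) (comp c2))
  | For v c => count_loop (var v) size_reg (comp c)
  | Print v => print (var v)
  | PrintEnd => say reg EndPath
  | Then c1 c2 => Seq (comp c1) (comp c2)
  end.

Definition program c := Seq (boot reg) (Seq (read_size size_reg) (comp c)).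

(** * Correctness of the compiler *)

Section Compilation.
Variables (n : nat) (e : rel 'I_n) (L S : nat).
Hypotheses (lt_nL : n < 2 ^ L) (lt_LS : L < S).
Local Notation w := (graph_code e).
Local Notation sem := (sem n (adjacency e)).

Definition regs (R : V -> nat) (k : reg) : nat :=
  if k is Some a then operand n R a else 0.

Definition models (s : store) :=
  @stores reg w L (regs s.1) (fun=> True) s.2.

Lemma regs_upd R v a : upd (regs R) (var v) a = regs (upd R v a).
Proof.
by apply: functional_extensionality => -[[u|]|] //=; rewrite /upd /=;
  rewrite (inj_eq Some_inj) // (inj_eq Some_inj).
Qed.

Lemma triple_if_flag Q b I o p q P :
  @triple reg w S (stores w L Q I o) (if b then p else q) P ->
  @triple reg w S (stores_flag w L Q b I o) (if_flag p q) P.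
Proof.
move=> h m Qm; have [|m' ex Pm'] := h m; first by exists b.
exists m' => //; move: Qm ex => [wd [i [_ _ _ ->]]] ex.
apply: exec_ite; first exact: leq_ltn_trans lt_LS.
by rewrite /holds /=; case: b {h} ex.
Qed.

Lemma triple_nop P : (forall m : memory (cell reg), P m -> wpos m < S) ->
  @triple reg w S P nop P.
Proof.
move=> lt_P m Pm; exists m => //.
have := exec_prim w (fun x _ a => idle x a) (lt_P m Pm).
by rewrite idleE.
Qed.

Lemma comp_correct c s : well_formed c -> bounded n s ->
  @triple reg w S (models s) (comp c) (models (sem c s)).
Proof.
have nopP s' : @triple reg w S (models s') nop (models s').
  by apply: triple_nop => m Pm; apply: (stores_lt lt_LS Pm).
elim: c s => //=.
- move=> v a s _ bs; rewrite /models /= -regs_upd.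
  exact: (@triple_copy _ _ _ _ lt_LS (var v) (reg_of a)).
- by move=> v s _ bs; rewrite /models /= -regs_upd; apply: (triple_clear lt_LS).
- move=> v s _ bs; apply: triple_seq.
    exact: (triple_compare lt_LS (var v) size_reg).
  apply: triple_if_flag; rewrite /=; case: eqVneq => [_|neq]; first exact: nopP.
  rewrite /models /= -regs_upd.
  apply: (triple_incr lt_nL lt_LS (k := var v)).
  by rewrite /= ltn_neqAle neq bs.
- move=> a b c1 IH1 c2 IH2 s /andP[wf1 wf2] bs; apply: triple_seq.
    exact: (triple_compare lt_LS (reg_of a) (reg_of b)).
  apply: triple_if_flag; rewrite /=; case: ifP => _; [exact: IH1|exact: IH2].
- move=> u v c1 IH1 c2 IH2 s /andP[wf1 wf2] bs; apply: triple_seq.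
    by apply: (triple_find_edge (e := e) lt_nL lt_LS); rewrite //= ?bs.
  apply: triple_if_flag; rewrite /=; case: ifP => _; [exact: IH1|exact: IH2].
- move=> v c IH s /andP[frame wf_c] bs.
  pose si i := iteri i (fun i s => sem c (upd s.1 v i, s.2)) s.
  have bsi i : i <= n -> bounded n (si i).
    elim: i => //= i IHi lt_i.
    by apply/bounded_sem/bounded_upd/ltnW => //; apply/IHi/ltnW.
  rewrite /models /=.
  apply: (triple_count_loop lt_nL lt_LS (Qs := fun i => regs (upd (si i).1 v i))
    (Is := fun _ _ => True) (os := fun i => (si i).2)) => //.
  + by rewrite regs_upd.
  + by move=> i _; rewrite /= upd_same.
  (* The store after the body, before the increment; by the frame property its counter is still
     [i]. *)
  move=> i lt_i; exists (regs (si i.+1).1); split.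
  + by rewrite /= sem_frame //= upd_same.
  + by rewrite regs_upd.
  apply: (IH (upd (si i).1 v i, (si i).2)) => //.
  by apply: bounded_upd; [apply/bsi/ltnW|apply: ltnW].
- by move=> v s _ bs; rewrite /models /=; apply: (triple_print lt_LS (var v)).
- by move=> s _ bs; apply: (triple_say lt_LS).
- move=> c1 IH1 c2 IH2 s /andP[wf1 wf2] bs.
  by apply: triple_seq (IH1 _ wf1 bs) (IH2 _ wf2 _); apply: bounded_sem.
Qed.

Lemma program_correct c : 0 < L -> well_formed c -> exists m,
  [/\ exec w S (program c)
        (Memory false 0 (fun=> (false, false, [ffun=> false]) : cell reg) 0 [::]) m,
      wpos m < S & out m = (sem c (fun=> 0, [::])).2].
Proof.
move=> L_gt0 wf_c; have [m1 ex1 m1P] := exec_boot e reg lt_LS L_gt0.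
have [m2 ex2 m2P] := @triple_read_size n e reg L S lt_nL lt_LS size_reg m1 m1P.
have m2P' : models (fun=> 0, [::]) m2.
  case: m2P => [b [wd [i [fitQ _ le_i ->]]]].
  have QE : upd (fun=> 0) size_reg n = regs (fun=> 0).
    by apply: functional_extensionality => -[[]|].
  by exists b, wd, i; rewrite -QE.
have [m3 ex3 m3P] := @comp_correct c (fun=> 0, [::]) wf_c (fun=> leq0n n) m2 m2P'.
exists m3; split.
- by apply: exec_seq ex1 _; apply: exec_seq ex2 ex3.
- exact: (stores_lt lt_LS m3P).
- by case: m3P => [b [wd [i [_ _ _ ->]]]].
Qed.

End Compilation.

Definition blank_cell : cell reg := (false, false, [ffun=> false]).

Lemma machine_computes c : well_formed c ->
  logspace (machine blank_cell (program c)) /\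
  forall n (e : rel 'I_n), halts_with (machine blank_cell (program c))
    (graph_code e) (sem n (adjacency e) c (fun=> 0, [::])).2.
Proof.
move=> wf_c; set M := machine _ _.
have runM n (e : rel 'I_n) :
    halts_with M (graph_code e) (sem n (adjacency e) c (fun=> 0, [::])).2 /\
    work_space_le M (graph_code e) (2 * (trunc_log 2 n).+1).
  (* [(trunc_log 2 n).+1] digits hold every value up to [n]. A sweep also visits the cell after the
     last digit, so more cells than digits are needed; the factor 2 provides them. *)
  have [||m [ex_m lt_m <-]] := @program_correct n e (trunc_log 2 n).+1
    (2 * (trunc_log 2 n).+1) _ _ c (ltn0Sn _) wf_c.
  - exact: trunc_log_ltn.
  - by rewrite ltn_Pmull.
  exact: machine_halts ex_m lt_m.
split; first by exists 2 => n e _; apply: (runM n e).2.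
by move=> n e; apply: (runM n e).1.
Qed.

End Language.

(** * Pairing incoming and outgoing arcs *)

Lemma onth_uniq (T : eqType) (s : seq T) i x : uniq s ->
  (onth s i == Some x) = (x \in s) && (index x s == i).
Proof.
move=> uniq_s; apply/eqP/andP => [si|[x_s /eqP<-]].
  have lt_i : i < size s by rewrite -onthTE si.
  have <- : nth x s i = x by apply: onth_nth.
  by rewrite mem_nth // index_uniq.
by rewrite onthE (nth_map x) ?nth_index // index_mem.
Qed.

Section Pairing.
Variables (T : finType) (e : rel T).

Definition preds b := [seq a <- enum T | e a b].
Definition succs a := [seq b <- enum T | e a b].

Definition follow (x : T * T) : option (T * T) :=
  omap (pair x.2) (onth (succs x.2) (index x.1 (preds x.2))).

(** The fuel [h] bounds the number of arcs, since [follow] can be iterated forever on a graph with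
    cycles. *)
Fixpoint trail h x := if h is h'.+1 then x :: oapp (trail h') [::] (follow x) else [::].

(** The outgoing arcs of rank at least the indegree of their tail, that is, those paired with no
    incoming arc. *)
Definition starts := [seq (v, u) | v <- enum T, u <- drop (size (preds v)) (succs v)].

Definition trail_path h (x : T * T) := x.1 :: map snd (trail h x).

Definition paired_paths := map (trail_path #|T|) starts.

Lemma mem_preds a b : (a \in preds b) = e a b.
Proof. by rewrite mem_filter mem_enum andbT. Qed.

Lemma mem_succs a b : (b \in succs a) = e a b.
Proof. by rewrite mem_filter mem_enum andbT. Qed.

Lemma uniq_preds b : uniq (preds b).
Proof. by rewrite filter_uniq ?enum_uniq. Qed.

Lemma uniq_succs a : uniq (succs a).
Proof. by rewrite filter_uniq ?enum_uniq. Qed.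


Lemma followP x y : reflect
  [/\ y.1 = x.2, e y.1 y.2 & index y.2 (succs y.1) = index x.1 (preds y.1)]
  (follow x == Some y).
Proof.
case: x y => a b [b' c]; rewrite /follow /=.
apply: (iffP idP) => [|[-> e_bc idx]].
  case Ec: onth => [c'|] //= /eqP[<- <-]; move/eqP: Ec.
  by rewrite onth_uniq ?uniq_succs // mem_succs => /andP[-> /eqP].
suff /eqP-> : onth (succs b) (index a (preds b)) == Some c by [].
by rewrite onth_uniq ?uniq_succs // mem_succs e_bc idx eqxx.
Qed.

(** The successor [y] determines the vertex where the arcs meet, and its rank among the arcs leaving
    that vertex is the rank of the arc that enters. *)
Lemma follow_inj x x' y : e x.1 x.2 -> e x'.1 x'.2 ->
  follow x = Some y -> follow x' = Some y -> x = x'.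
Proof.
case: x x' => a b [a' b'] /= e_ab e_ab'.
move=> /eqP/followP[/= y1 _ idx] /eqP/followP[/= y1' _ idx'].
have eq_b : b' = b by rewrite -y1.
rewrite eq_b in e_ab' *; congr (_, _).
by apply: (@index_inj _ b (preds b)); rewrite ?mem_preds // -y1 -idx.
Qed.

Lemma mem_starts x : (x \in starts) =
  e x.1 x.2 && (size (preds x.1) <= index x.2 (succs x.1)).
Proof.
case: x => a b /=; have mem_drop k (s : seq T) c : uniq s ->
    (c \in drop k s) = (c \in s) && (k <= index c s).
  move=> uniq_s; have [c_s|nc_s] := boolP (c \in s); last first.
    by apply: contraNF nc_s; apply: mem_drop.
  rewrite leqNgt -in_take //=; move: uniq_s c_s.
  rewrite -{1 2}(cat_take_drop k s) cat_uniq mem_cat => /and3P[_ /hasPn disj _].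
  by case: (boolP (c \in drop k s)) => [/disj->|_] //; rewrite orbF => ->.
apply/allpairsPdep/andP => [[v [u [_ + [-> ->]]]]|[e_ab le_idx]].
  by rewrite mem_drop ?uniq_succs // mem_succs => /andP.
exists a, b; split; rewrite ?mem_enum //.
by rewrite mem_drop ?uniq_succs // mem_succs e_ab.
Qed.

Lemma starts_unfollowed x y : e x.1 x.2 -> follow x = Some y -> y \notin starts.
Proof.
move=> e_x /eqP/followP[y1 _ idx]; rewrite mem_starts negb_and -ltnNge idx.
by rewrite index_mem y1 mem_preds e_x orbT.
Qed.

Lemma follow_exists y : e y.1 y.2 -> y \notin starts ->
  exists2 x, e x.1 x.2 & follow x = Some y.
Proof.
case: y => b c /= e_bc; rewrite mem_starts /= e_bc -ltnNge => lt_idx.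
pose a := nth b (preds b) (index c (succs b)).
have a_b : a \in preds b by apply: mem_nth.
exists (a, b); first by rewrite -mem_preds.
by apply/eqP/followP; rewrite /= index_uniq ?uniq_preds.
Qed.

Lemma uniq_starts : uniq starts.
Proof.
apply: allpairs_uniq_dep => [|v _|[v u] [v' u'] _ _ /= [-> ->] //].
  exact: enum_uniq.
by rewrite drop_uniq ?uniq_succs.
Qed.

Definition follow_iter i x := iter i (obind follow) (Some x).

Lemma iter_follow_none i : iter i (obind follow) None = None.
Proof. by elim: i => //= i ->. Qed.

Lemma follow_iter_arc i x y :
  e x.1 x.2 -> follow_iter i x = Some y -> e y.1 y.2.
Proof.
case: i => [e_x [<-] //|i] _; rewrite /follow_iter iterS.
by case: (iter i _ _) => //= z /eqP/followP[].
Qed.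

Lemma mem_trail h x y :
  reflect (exists2 i, i < h & follow_iter i x = Some y) (y \in trail h x).
Proof.
elim: h x => [|h IHh] x /=; first by apply: (iffP idP) => // -[].
rewrite inE; apply: (iffP orP).
  case=> [/eqP->|]; first by exists 0.
  case Ex: (follow x) => [z|] //= /IHh[i lt_i Ey].
  by exists i.+1 => //; rewrite /follow_iter iterSr /= Ex.
case=> -[_ [->]|i lt_i]; first by left.
rewrite /follow_iter iterSr /=; case: (follow x) => [z|] /= Ey.
  by right; apply/IHh; exists i.
by rewrite iter_follow_none in Ey.
Qed.

(** Both chains are walked back from [y] in step: predecessors are unique by [follow_inj], and a
    start has none, so the two walks end together. *)
Lemma start_unique x x' i j y : x \in starts -> x' \in starts ->
  follow_iter i x = Some y -> follow_iter j x' = Some y -> x = x'.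
Proof.
move=> Sx Sx'; have e_start z : z \in starts -> e z.1 z.2.
  by rewrite mem_starts => /andP[].
elim: i j y => [|i IHi] [|j] y.
- by move=> [->] [->].
- move=> [<-]; rewrite /follow_iter iterS -/(follow_iter j x').
  case Ez: (follow_iter j x') => [z|] //= Ex.
  by have := starts_unfollowed (follow_iter_arc (e_start _ Sx') Ez) Ex; rewrite Sx.
- move=> + [Ey]; rewrite -Ey /follow_iter iterS -/(follow_iter i x).
  case Ez: (follow_iter i x) => [z|] //= Ex.
  by have := starts_unfollowed (follow_iter_arc (e_start _ Sx) Ez) Ex; rewrite Sx'.
rewrite /follow_iter !iterS -/(follow_iter i x) -/(follow_iter j x').
case Ez: (follow_iter i x) => [z|] //= fz; case Ez': (follow_iter j x') => [z'|] //= fz'.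
apply: (IHi j z Ez); rewrite Ez'; congr Some; symmetry.
apply: follow_inj fz fz'.
  exact: follow_iter_arc (e_start _ Sx) Ez.
exact: follow_iter_arc (e_start _ Sx') Ez'.
Qed.

Lemma arcs_trail_path h x : arcs (trail_path h x) = trail h x.
Proof.
rewrite /arcs /trail_path /=; elim: h x => //= h IHh [a b] /=.
case Ex: (follow (a, b)) => [y|] //=; congr (_ :: _).
by have /eqP/followP[/= y1 _ _] := Ex; have := IHh y; rewrite y1.
Qed.

Lemma path_trail h x : e x.1 x.2 -> path e x.1 (map snd (trail h x)).
Proof.
elim: h x => //= h IHh [a b] /= e_ab; rewrite e_ab /=.
case Ex: (follow (a, b)) => [y|] //=.
by have /eqP/followP[/= <- e_y _] := Ex; apply: IHh.
Qed.

Lemma size_trail i x y : follow_iter i x = Some y -> size (trail i.+1 x) = i.+1.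
Proof.
elim: i x => [|i IHi] x; first by move=> _ /=; case: (follow x).
rewrite /follow_iter iterSr [trail _ _]/= /=.
case: (follow x) => [z|] /=; first by move=> /IHi /= [->].
by rewrite iter_follow_none.
Qed.

(** * Acyclic graphs: the chains form a path decomposition *)

Hypothesis acyclic_e : acyclic e.

(** The number of ancestors, a potential that increases strictly along the arcs of an acyclic
    graph. *)
Definition height x := #|[set y | connect e y x]|.

Lemma height_arc x y : e x y -> height x < height y.
Proof.
move=> e_xy; apply/proper_card/properP; split.
  apply/subsetP=> z; rewrite !inE => /connect_trans; apply; exact: connect1.
exists y; rewrite inE ?connect0 //; apply/negP=> /connectP[p e_p x_last].
case: (shortenP e_p) x_last => q e_q uniq_q _ x_last.
suff /acyclic_e : ucycle e (y :: q) by [].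
by rewrite /ucycle uniq_q andbT /= rcons_path e_q -x_last.
Qed.

Lemma uniq_path x p : path e x p -> uniq (x :: p).
Proof.
move=> e_p; apply: (@map_uniq _ _ height).
apply: (sorted_uniq ltn_trans ltnn); rewrite /= path_map.
by apply: sub_path e_p => y z /height_arc.
Qed.

(** Going back along the pairing lowers the height of the tail, so it must end at a start. *)
Lemma start_exists y : e y.1 y.2 ->
  exists x i, x \in starts /\ follow_iter i x = Some y.
Proof.
move: {2}(height y.1).+1 (ltnSn (height y.1)) => k.
elim: k y => // k IHk y lt_k e_y; have [Sy|nSy] := boolP (y \in starts).
  by exists y, 0.
have [z e_z fz] := follow_exists e_y nSy.
have [|//|x [i [Sx Ei]]] := IHk z.
  rewrite ltnS in lt_k; apply: leq_trans lt_k.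
  by have /eqP/followP[-> _ _] := fz; apply: height_arc.
by exists x, i.+1; split=> //; rewrite /follow_iter iterS -/(follow_iter i x) Ei.
Qed.

Lemma paired_paths_decomposition : path_decomposition e paired_paths.
Proof.
have e_start z : z \in starts -> e z.1 z.2 by rewrite mem_starts => /andP[].
split=> [|a b e_ab].
  apply/allP=> p /mapP[x /e_start e_x ->]; rewrite /simple_path /=.
  by rewrite path_trail //; have := uniq_path (path_trail #|T| e_x).
have [x [i [Sx Ex]]] := @start_exists (a, b) e_ab.
(* A chain of [i.+1] arcs visits [i.+2] distinct vertices; hence the fuel [#|T|] is enough to reach
   every arc. *)
have lt_i : i < #|T|.
  move: (trail i.+1 x) (path_trail i.+1 (e_start _ Sx)) (size_trail Ex).
  move=> t /uniq_path/card_uniqP E sz_t; have := max_card (mem (x.1 :: map snd t)).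
  by rewrite E /= size_map sz_t; apply: ltnW.
rewrite count_map (eq_in_count (a2 := pred1 x)).
  by rewrite (count_uniq_mem _ uniq_starts) Sx.
move=> x' Sx' /=; rewrite arcs_trail_path; apply/idP/eqP => [/mem_trail[j _ Ej]|->].
  exact: start_unique Sx' Sx Ej Ex.
by apply/mem_trail; exists i.
Qed.

(** * Optimality by counting degrees *)

Lemma size_starts : size starts = \sum_v (size (succs v) - size (preds v)).
Proof.
rewrite size_allpairs_dep sumnE big_map big_enum.
by apply: eq_bigr => v _; rewrite size_drop.
Qed.

Lemma size_filter_enum (P : pred T) : size (filter P (enum T)) = \sum_u P u.
Proof. by rewrite size_filter -sum1_count big_mkcond big_enum. Qed.

Lemma sum_arcs (s : seq (T * T)) v : uniq s ->
  (\sum_u ((v, u) \in s) = count (fun x => x.1 == v) s) /\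
  (\sum_u ((u, v) \in s) = count (fun x => x.2 == v) s).
Proof.
elim: s => [|[a b] s IHs] /=; first by rewrite !big1.
move=> /andP[nab_s /IHs[<- <-]].
have sum_eq c (P : bool) : \sum_(u : T) (P && (u == c)) = P.
  rewrite (bigD1 c) //= eqxx andbT big1 ?addn0 // => u /negPf->.
  by rewrite andbF.
have memE x : (x \in (a, b) :: s) = (x == (a, b)) + (x \in s) :> nat.
  by rewrite inE; case: eqP => [->|] //=; rewrite (negPf nab_s).
split.
  rewrite -[in RHS](sum_eq b) -big_split; apply: eq_bigr => u _.
  by rewrite memE xpair_eqE [v == a]eq_sym.
rewrite -[in RHS](sum_eq a) -big_split; apply: eq_bigr => u _.
by rewrite memE xpair_eqE [v == b]eq_sym andbC.
Qed.

(** Both sizes are sums over the vertices, compared term by term. At each vertex, outdegree and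
    indegree are split over the paths of [D], and the inequality is checked on a single path. *)
Lemma paired_paths_minimal D :
  path_decomposition e D -> size paired_paths <= size D.
Proof.
move=> [simple_D cover_D]; rewrite size_map size_starts.
(* Each path is charged to its first vertex. *)
have -> : size D = \sum_v \sum_(p <- D) (ohead p == Some v).
  rewrite exchange_big /= -sum1_size !big_seq; apply: eq_bigr => p.
  move=> /(allP simple_D)/and3P[]; case: p => // x p _ _ _.
  rewrite (bigD1 x) //= eqxx big1 // => v neq_v.
  by rewrite (inj_eq Some_inj) eq_sym (negPf neq_v).
have arc_D p x y : p \in D -> (x, y) \in arcs p -> e x y.
  move=> /(allP simple_D)/and3P[_ + _]; case: p => // a p /=.
  elim: p a => //= b p IHp a /andP[e_ab e_p]; rewrite inE.
  by case/orP=> [/eqP[-> ->]|] //; apply: IHp.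
(* An arc lies on exactly one path and a non-arc on none, so adjacency is itself a sum over the
   paths. *)
have degree x y : (e x y : nat) = \sum_(p <- D) ((x, y) \in arcs p).
  case: (boolP (e x y)) => [/cover_D|ne_xy].
    by rewrite -sum1_count big_mkcond => /esym.
  rewrite big_seq big1 // => p p_D.
  by case: (boolP (_ \in _)) => // /(arc_D _ _ _ p_D); rewrite (negPf ne_xy).
apply: leq_sum => v _; rewrite leq_subLR !size_filter_enum.
rewrite (eq_bigr _ (fun u _ => degree v u)) (eq_bigr _ (fun u _ => degree u v)).
rewrite exchange_big [X in _ <= X + _]exchange_big -big_split /=.
rewrite !big_seq; apply: leq_sum => p /(allP simple_D)/and3P[].
case: p => // x p _ _ uniq_p.
have uniq_arcs : uniq (arcs (x :: p)).
  apply: (@map_uniq _ _ snd); rewrite -/unzip2 unzip2_zip //.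
  by case/andP: uniq_p.
have [-> ->] := sum_arcs v uniq_arcs.
have -> : count (fun a => a.2 == v) (arcs (x :: p)) = count_mem v p.
  by rewrite -(count_map snd (pred1 v)) -/unzip2 unzip2_zip.
(* Every vertex but the last is the tail of one arc of the path; the last vertex makes this an
   inequality. *)
have le_v : count (fun a => a.1 == v) (arcs (x :: p)) <= count_mem v (x :: p).
  rewrite -(count_map fst (pred1 v)) -/unzip1 /arcs /=.
  elim: p x {uniq_p uniq_arcs} => //= y p IHp x.
  by rewrite leq_add2l.
by rewrite addnC (inj_eq Some_inj).
Qed.

Lemma paired_paths_optimal : minimal_path_decomposition e paired_paths.
Proof.
by split; [exact: paired_paths_decomposition|exact: paired_paths_minimal].
Qed.

End Pairing.

(** * The program *)

Section Loops.
Variables (V : finType) (n : nat) (edge : nat -> nat -> bool).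
Local Notation sem := (sem n edge).

(** The first [i] rounds of [For v c]; invariants are proved by induction on [i]. *)
Definition loop c (v : V) i s := iteri i (fun i s => sem c (upd s.1 v i, s.2)) s.

Lemma loop_frame c v i s x : ~~ writes (For v c) x -> (loop c v i s).1 x = s.1 x.
Proof.
rewrite /= negb_or => /andP[/negPf neq_v frame]; elim: i => //= i IHi.
by rewrite sem_frame //= /upd neq_v.
Qed.

Fixpoint silent (c : cmd V) :=
  match c with
  | Print _ | PrintEnd => false
  | IfEq _ _ c1 c2 | IfEdge _ _ c1 c2 | Then c1 c2 => silent c1 && silent c2
  | For _ c => silent c
  | _ => true
  end.

Lemma sem_silent c s : silent c -> (sem c s).2 = s.2.
Proof.
elim: c s => //=.
- by move=> a b c1 IH1 c2 IH2 s /andP[/IH1 E1 /IH2 E2]; case: ifP.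
- by move=> a b c1 IH1 c2 IH2 s /andP[/IH1 E1 /IH2 E2]; case: ifP.
- move=> v c IH s /IH E; suff: forall i, (loop c v i s).2 = s.2 by apply.
  by elim=> //= i IHi; rewrite E.
- by move=> c1 IH1 c2 IH2 s /andP[/IH1 E1 /IH2 E2]; rewrite E2.
Qed.

Lemma sem_then (c1 c2 : cmd V) s : sem (Then c1 c2) s = sem c2 (sem c1 s).
Proof. by []. Qed.

End Loops.

Lemma iotaSr m i : iota m i.+1 = rcons (iota m i) (m + i).
Proof. by rewrite -[i.+1]addn1 iotaD cats1. Qed.

(* [rv, rw] is the first arc of the current path and [ra, rb] its current arc,
   with [rb = n] once the path has ended; [rp] counts the arcs entering [rv] and
   [rd] those leaving it, the latter only up to [rp]; [rr] is the rank of
   [ra, rb] among the arcs entering [rb]. *)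
Definition register := 'I_11.
Definition rv : register := @Ordinal 11 0 isT.
Definition rw : register := @Ordinal 11 1 isT.
Definition ra : register := @Ordinal 11 2 isT.
Definition rb : register := @Ordinal 11 3 isT.
Definition ru : register := @Ordinal 11 4 isT.
Definition rh : register := @Ordinal 11 5 isT.
Definition rd : register := @Ordinal 11 6 isT.
Definition rp : register := @Ordinal 11 7 isT.
Definition rk : register := @Ordinal 11 8 isT.
Definition rr : register := @Ordinal 11 9 isT.
Definition ry : register := @Ordinal 11 10 isT.

Definition indegree : cmd register :=
  Then (Zero rp) (For ru (IfEdge ru rv (Incr rp) (Nop _))).

(** The test precedes the increment: when [ru] reaches [ra], [rk] counts the predecessors of [rb]
    smaller than [ra]. *)
Definition rank : cmd register :=
  Then (Zero rk) (For ru (Then (IfEq (Some ru) (Some ra) (Set_ rr (Some rk)) (Nop _))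
                               (IfEdge ru rb (Incr rk) (Nop _)))).

(** [ry] starts as [n] and keeps this value if no arc of rank [rr] leaves [rb]; as the next [rb] it
    then ends the path. *)
Definition select : cmd register :=
  Then (Set_ ry None) (Then (Zero rk)
    (For ru (IfEdge rb ru
       (Then (IfEq (Some rk) (Some rr) (Set_ ry (Some ru)) (Nop _)) (Incr rk))
       (Nop _)))).

Definition advance_arc : cmd register :=
  Then rank (Then select (Then (Set_ ra (Some rb)) (Set_ rb (Some ry)))).

(* In an acyclic graph a path has at most [n] vertices, so [n] rounds suffice;
   bounding their number makes the program terminate on all graphs. *)
Definition print_path : cmd register :=
  Then (Set_ ra (Some rv)) (Then (Set_ rb (Some rw)) (Then (Print rv)
    (Then (For rh (IfEq (Some rb) None (Nop _) (Then (Print rb) advance_arc)))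
      (PrintEnd _)))).

(** The first [rp] arcs leaving [rv] continue other paths and only raise [rd]; once [rd] equals
    [rp], each further arc begins a path. [print_path] writes none of [rv], [rw], [rd], [rp]. *)
Definition print_paths_from : cmd register :=
  Then indegree (Then (Zero rd)
    (For rw (IfEdge rv rw
      (IfEq (Some rd) (Some rp) print_path (Incr rd)) (Nop _)))).

Definition print_decomposition : cmd register := For rv print_paths_from.

Ltac decide_registers :=
  repeat match goal with
  | |- context [@eq_op ?T ?x ?y] =>
      let b := eval vm_compute in (@eq_op T x y) in
      match b with
      | true => change (@eq_op T x y) with true
      | false => change (@eq_op T x y) with false
      end
  end; cbv iota.

(** * The program prints the paired paths *)

Section Correctness.
Variables (n : nat) (e : rel 'I_n).
Local Notation edge := (adjacency e).
Local Notation sem := (sem n edge).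
Local Notation loop := (loop n edge).

(** Predecessors, and below successors, among the vertices smaller than [m]: what a [For] loop has
    seen after [m] rounds. *)
Definition npreds b m := [seq a <- iota 0 m | edge a b].
Definition nsuccs a m := [seq b <- iota 0 m | edge a b].

Lemma npredsS b m : npreds b m.+1 =
  if edge m b then rcons (npreds b m) m else npreds b m.
Proof. by rewrite /npreds iotaSr filter_rcons. Qed.

Lemma nsuccsS a m : nsuccs a m.+1 =
  if edge a m then rcons (nsuccs a m) m else nsuccs a m.
Proof. by rewrite /nsuccs iotaSr filter_rcons. Qed.

Lemma size_npreds b m : size (npreds b m) <= m.
Proof. by rewrite size_filter -[X in _ <= X](size_iota 0 m) count_size. Qed.

Lemma size_nsuccs a m : size (nsuccs a m) <= m.
Proof. by rewrite size_filter -[X in _ <= X](size_iota 0 m) count_size. Qed.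

Lemma sem_indegree s : (sem indegree s).1 rp = size (npreds (s.1 rv) n).
Proof.
set s0 : store _ := (upd s.1 rp 0, s.2).
pose si i := loop (IfEdge ru rv (Incr rp) (Nop _)) ru i s0.
suff rpE i : i <= n -> (si i).1 rp = size (npreds (s.1 rv) i).
  by rewrite -(rpE n (leqnn n)).
elim: i => [_|i IHi lt_i]; first by rewrite /= upd_same.
have rvE : (si i).1 rv = s.1 rv by rewrite loop_frame.
rewrite /si /loop iteriS -/(loop _ _ _ _) -/(si i) npredsS /=.
rewrite /upd; decide_registers; rewrite rvE; case: ifP => _ /=; decide_registers.
  (* At most [i < n] arcs have been counted, so [Incr] does not saturate. *)
  rewrite IHi 1?ltnW // size_rcons; case: eqP => // E; move: lt_i.
  by rewrite -{1}E ltnNge size_npreds.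
by rewrite IHi 1?ltnW.
Qed.

Lemma sem_rank s : s.1 ra < n ->
  (sem rank s).1 rr = size (npreds (s.1 rb) (s.1 ra)).
Proof.
move=> lt_a; set s0 : store _ := (upd s.1 rk 0, s.2).
pose si i := loop (Then (IfEq (Some ru) (Some ra) (Set_ rr (Some rk)) (Nop _))
                        (IfEdge ru rb (Incr rk) (Nop _))) ru i s0.
suff rkE i : i <= n -> (si i).1 rk = size (npreds (s.1 rb) i) /\
    (s.1 ra < i -> (si i).1 rr = size (npreds (s.1 rb) (s.1 ra))).
  by rewrite -((rkE n (leqnn n)).2 lt_a).
elim: i => [_|i IHi lt_i]; first by split; rewrite /= ?upd_same.
have [IHk IHr] := IHi (ltnW lt_i).
have raE : (si i).1 ra = s.1 ra by rewrite loop_frame.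
have rbE : (si i).1 rb = s.1 rb by rewrite loop_frame.
rewrite /si /loop iteriS -/(loop _ _ _ _) -/(si i) npredsS /=.
rewrite /upd; decide_registers; rewrite raE.
split.
  case: (i == _) => /=; decide_registers; rewrite rbE; case: ifP => _ /=;
  decide_registers; rewrite IHk ?size_rcons //; case: eqP => // E;
  by move: lt_i; rewrite -{1}E ltnNge size_npreds.
rewrite ltnS leq_eqVlt eq_sym; case: eqVneq => [E _|neq /IHr E] /=;
  decide_registers; rewrite rbE; case: ifP => _ /=; decide_registers;
  try (case: ifP => _ /=; decide_registers);
  first [by rewrite IHk -E | by rewrite E].
Qed.

Lemma sem_select s :
  (sem select s).1 ry = nth n (nsuccs (s.1 rb) n) (s.1 rr).
Proof.
set s0 : store _ := (upd (upd s.1 ry n) rk 0, s.2).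
pose si i := loop (IfEdge rb ru
       (Then (IfEq (Some rk) (Some rr) (Set_ ry (Some ru)) (Nop _)) (Incr rk))
       (Nop _)) ru i s0.
suff ryE i : i <= n -> (si i).1 rk = size (nsuccs (s.1 rb) i) /\
    (si i).1 ry = nth n (nsuccs (s.1 rb) i) (s.1 rr).
  by rewrite -(ryE n (leqnn n)).2.
elim: i => [_|i IHi lt_i]; first by split; rewrite //= nth_nil.
have [IHk IHy] := IHi (ltnW lt_i).
have rrE : (si i).1 rr = s.1 rr by rewrite loop_frame.
have rbE : (si i).1 rb = s.1 rb by rewrite loop_frame.
rewrite /si /loop iteriS -/(loop _ _ _ _) -/(si i) nsuccsS /=.
rewrite /upd; decide_registers; rewrite rbE; case: ifP => _ /=; decide_registers => //.
have neq_n : (size (nsuccs (s.1 rb) i) == n) = false.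
  by apply/negbTE; rewrite neq_ltn (leq_ltn_trans (size_nsuccs _ _) lt_i).
rewrite rrE IHk nth_rcons; split.
  by case: (_ == s.1 rr) => /=; decide_registers; rewrite IHk neq_n;
    decide_registers; rewrite ?IHk size_rcons.
rewrite [s.1 rr == _]eq_sym; case E: (_ == s.1 rr) => /=; decide_registers;
  rewrite IHk neq_n; decide_registers; first by rewrite -(eqP E) ltnn.
by rewrite IHy; case: ltnP => // le; rewrite nth_default.
Qed.

Lemma sem_advance_arc s : s.1 ra < n ->
  (sem advance_arc s).1 ra = s.1 rb /\
  (sem advance_arc s).1 rb =
    nth n (nsuccs (s.1 rb) n) (size (npreds (s.1 rb) (s.1 ra))).
Proof.
move=> lt_a; rewrite /advance_arc (sem_then _ _ rank) (sem_then _ _ select).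
set s1 := sem rank s; set s2 := sem select s1.
have rb1 : s1.1 rb = s.1 rb by rewrite sem_frame.
have rb2 : s2.1 rb = s.1 rb by rewrite sem_frame.
have ry2 : s2.1 ry = nth n (nsuccs (s.1 rb) n) (size (npreds (s.1 rb) (s.1 ra))).
  by rewrite sem_select rb1 sem_rank.
move: s2 rb2 ry2 => s2 rb2 ry2.
by split; rewrite /= /upd; decide_registers.
Qed.

Lemma edgeE (i j : 'I_n) : edge i j = e i j.
Proof. by rewrite /adjacency !valK. Qed.

Lemma npredsE (b : 'I_n) : npreds b n = map val (preds e b).
Proof.
rewrite /npreds -val_enum_ord filter_map; congr map.
by apply: eq_filter => a; rewrite /= edgeE.
Qed.

Lemma nsuccsE (a : 'I_n) : nsuccs a n = map val (succs e a).
Proof.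
rewrite /nsuccs -val_enum_ord filter_map; congr map.
by apply: eq_filter => b; rewrite /= edgeE.
Qed.

(** [preds] lists vertices in increasing order, so the position of [a] is the number of smaller
    predecessors, which is what the program counts. *)
Lemma rankE (a b : 'I_n) : e a b -> size (npreds b a) = index a (preds e b).
Proof.
move=> e_ab; rewrite -(index_map val_inj) -npredsE /npreds.
have -> : iota 0 n = iota 0 a ++ val a :: iota a.+1 (n - a.+1).
  by rewrite -[X in iota 0 X](subnKC (ltnW (ltn_ord a))) iotaD -(subnSK (ltn_ord a)).
rewrite filter_cat index_cat mem_filter mem_iota ltnn !andbF /=.
by rewrite edgeE e_ab /= eqxx addn0.
Qed.

(** A chain that has ended is represented by [rb = n], with [ra] arbitrary. *)
Definition arc_state (o : option ('I_n * 'I_n)) (R : register -> nat) :=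
  if o is Some x then R ra = x.1 /\ R rb = x.2 else R rb = n.

Lemma arc_state_advance s x : e x.1 x.2 -> arc_state (Some x) s.1 ->
  arc_state (follow e x) (sem advance_arc s).1.
Proof.
move=> e_x [raE rbE]; have [|ra' rb'] := @sem_advance_arc s; first by rewrite raE.
rewrite raE rbE in ra' rb'; move: rb'; rewrite rankE // nsuccsE.
rewrite -odflt_onth onth_map /follow.
by case: onth => [y|] //= rb'; split.
Qed.

(** [trail] recurses on its first arc, while the printing loop appends arcs at the end; this
    unfolding at the far end matches one round, including the idle rounds after the chain has
    ended. *)
Lemma trailSr i (x : 'I_n * 'I_n) : trail e i.+1 x =
  trail e i x ++ (if follow_iter e i x is Some y then [:: y] else [::]).
Proof.
elim: i x => [|i IHi] x; first by rewrite /=; case: follow.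
rewrite [LHS]/= [trail e i.+1 x]/= /follow_iter iterSr /=; congr (_ :: _).
case: (follow e x) => [y|] /=; last by rewrite iter_follow_none.
by have := IHi y; rewrite /= => ->.
Qed.

Lemma sem_print_path (s : store register) (v u : 'I_n) :
  s.1 rv = v -> s.1 rw = u -> e v u ->
  (sem print_path s).2 = s.2 ++ path_code (trail_path e n (v, u)).
Proof.
move=> rvE rwE e_vu; set x := (v, u).
set s0 : store _ := (upd (upd s.1 ra v) rb u, s.2 ++ vertex_code v).
pose si i := loop (IfEq (Some rb) None (Nop _) (Then (Print rb) advance_arc)) rh i s0.
have siP i : arc_state (follow_iter e i x) (si i).1 /\
    (si i).2 = s0.2 ++ flatten [seq vertex_code y.2 | y <- trail e i x].
  elim: i => [|i [arc_i out_i]].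
    by split; rewrite /= ?cats0 //= /upd; decide_registers.
  rewrite /si /loop iteriS -/(loop _ _ _ _) -/(si i) trailSr.
  rewrite /follow_iter iterS -/(follow_iter e i x).
  set t := (upd (si i).1 rh i, (si i).2).
  have {arc_i} : arc_state (follow_iter e i x) t.1.
    by case: follow_iter arc_i => [y|] /=; rewrite /upd; decide_registers.
  have {out_i} : t.2 = s0.2 ++ flatten [seq vertex_code y.2 | y <- trail e i x] by [].
  move: t (@follow_iter_arc _ e i x) => t.
  have -> : sem (IfEq (Some rb) None (Nop _) (Then (Print rb) advance_arc)) t =
    if t.1 rb == n then t
    else sem advance_arc
      (t.1, t.2 ++ rcons [seq Digit b | b <- binary (t.1 rb)] EndVertex).
    by [].
  case: follow_iter => [y|] arc_y out_i arc_i; last first.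
    by rewrite arc_i eqxx cats0.
  have [_ rbE] := arc_i; rewrite rbE (ltn_eqF (ltn_ord _)); split.
    by apply: arc_state_advance => //; apply: arc_y.
  by rewrite sem_silent //= out_i map_cat flatten_cat /= cats0 !catA.
suff E : sem print_path s = (upd (si n).1 rh n, rcons (si n).2 EndPath).
  rewrite E /= (siP n).2 /= -catA rcons_cat; congr (s.2 ++ _).
  by rewrite /path_code /trail_path /= -map_comp.
rewrite /si /loop /s0 /vertex_code -rvE -rwE /= /upd; decide_registers.
by [].
Qed.

Lemma sem_print_paths_from (s : store register) (v : 'I_n) : s.1 rv = v ->
  (sem print_paths_from s).2 = s.2 ++
    flatten [seq path_code (trail_path e n (v, u)) |
             u <- drop (size (preds e v)) (succs e v)].
Proof.
move=> rvE; set C := size (preds e v).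
pose code i :=
  if insub i is Some u then path_code (trail_path e n (v, u)) else [::].
have -> : [seq path_code (trail_path e n (v, u)) | u <- drop C (succs e v)] =
    map code (drop C (nsuccs v n)).
  rewrite nsuccsE -map_drop -map_comp; apply: eq_map => u.
  by rewrite /code /= valK.
rewrite /print_paths_from (sem_then _ _ indegree).
have rp1 : (sem indegree s).1 rp = C by rewrite sem_indegree rvE npredsE size_map.
have rv1 : (sem indegree s).1 rv = v by rewrite sem_frame.
have out1 : (sem indegree s).2 = s.2 by rewrite sem_silent.
move: (sem indegree s) rp1 rv1 out1 => s1 rp1 rv1 <- {s rvE}.
set s0 : store _ := (upd s1.1 rd 0, s1.2).
pose body := IfEdge rv rw (IfEq (Some rd) (Some rp) print_path (Incr rd)) (Nop _).
pose si i := loop body rw i s0.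
(* [rd] stops growing at [C], hence the minimum; the arcs seen beyond the first [C] are those
   already printed as paths. *)
suff siP i : i <= n -> (si i).1 rd = minn C (size (nsuccs v i)) /\
    (si i).2 = s1.2 ++ flatten (map code (drop C (nsuccs v i))).
  exact: (siP n (leqnn n)).2.
elim: i => [|i IHi] lt_i; first by rewrite /= upd_same minn0 cats0.
have [IHd IHout] := IHi (ltnW lt_i).
have rp_i : (si i).1 rp = C by rewrite loop_frame.
have rv_i : (si i).1 rv = v by rewrite loop_frame.
rewrite /si /loop iteriS -/(loop _ _ _ _) -/(si i).
set t : store _ := (upd (si i).1 rw i, (si i).2).
have rdt : t.1 rd = minn C (size (nsuccs v i)) by [].
have rpt : t.1 rp = C by [].
have rvt : t.1 rv = v by [].
have rwt : t.1 rw = i by [].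
have outt : t.2 = s1.2 ++ flatten (map code (drop C (nsuccs v i))) by [].
move: t rdt rpt rvt rwt outt => t rdt rpt rvt rwt outt.
have -> : sem body t = if edge (t.1 rv) (t.1 rw) then
    if t.1 rd == t.1 rp then sem print_path t else sem (Incr rd) t else t.
  by [].
rewrite rvt rwt nsuccsS; case: ifP => // e_vi.
have e_vu : e v (Ordinal lt_i) by rewrite -edgeE.
have codeE : code i = path_code (trail_path e n (v, Ordinal lt_i)).
  by rewrite /code insubT.
rewrite rdt rpt size_rcons; case: (leqP C (size (nsuccs v i))) => le_C.
  rewrite eqxx sem_frame // rdt drop_rcons // map_rcons flatten_rcons catA -outt.
  rewrite codeE (@sem_print_path t v (Ordinal lt_i)) // !(minn_idPl _) //.
  exact: leq_trans le_C (leqnSn _).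
rewrite (ltn_eqF le_C) (minn_idPr le_C).
rewrite drop_oversize ?size_rcons // cats0.
move: outt; rewrite drop_oversize 1?ltnW // cats0 => outt.
rewrite /= rdt (minn_idPr (ltnW le_C)) ltn_eqF; last first.
  exact: leq_ltn_trans (size_nsuccs _ _) lt_i.
by rewrite upd_same.
Qed.

Lemma flatten_map_flatten (A B : Type) (f : A -> seq B) ss :
  flatten (map f (flatten ss)) = flatten [seq flatten (map f s) | s <- ss].
Proof. by elim: ss => //= s ss IHss; rewrite map_cat flatten_cat IHss. Qed.

Lemma sem_print_decomposition :
  (sem print_decomposition (fun=> 0, [::])).2 = decomposition_code (paired_paths e).
Proof.
pose outv (v : 'I_n) := flatten [seq path_code (trail_path e n (v, u)) |
             u <- drop (size (preds e v)) (succs e v)].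
pose code i := if insub i is Some v then outv v else [::].
have -> : decomposition_code (paired_paths e) = flatten (map code (iota 0 n)).
  rewrite /decomposition_code /paired_paths card_ord /starts -map_comp.
  rewrite flatten_map_flatten -val_enum_ord -!map_comp; congr flatten.
  by apply: eq_map => v; rewrite /= /code valK /outv -map_comp.
pose s0 : store register := (fun=> 0, [::]).
pose si i := loop print_paths_from rv i s0.
suff siP i : i <= n -> (si i).2 = flatten (map code (iota 0 i)).
  exact: siP n (leqnn n).
elim: i => // i IHi lt_i.
rewrite /si /loop iteriS -/(loop _ _ _ _) -/(si i).
rewrite (@sem_print_paths_from _ (Ordinal lt_i)) ?upd_same // iotaSr.
rewrite map_rcons flatten_rcons -IHi 1?ltnW // add0n.
by congr (_ ++ _); rewrite /code insubT.
Qed.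

End Correctness.

Theorem theorem2 :
  exists M : transducer,
    logspace M /\
    forall (n : nat) (e : rel 'I_n), irreflexive e -> acyclic e ->
      exists D : seq (seq 'I_n),
        minimal_path_decomposition e D /\
        halts_with M (graph_code e) (decomposition_code D).
Proof.
have [space halts] := @machine_computes register print_decomposition isT.
exists (machine (blank_cell register) (program print_decomposition)).
split=> // n e _ acyclic_e; exists (paired_paths e).
split; first exact: paired_paths_optimal.
by rewrite -sem_print_decomposition; apply: halts.
Qed.
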